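(* Let $\tilde{A}$ be the set of triples $(s,\alpha,\beta)$ with $s\in\mathbb{Q}\setminus\{0,\pm1\}$ and $(\alpha,\beta)\in E_{1,s}(\mathbb{Q})\setminus E_{1,s}(\mathbb{Q})_{\mathrm{tor}}$. For $(s,\alpha,\beta)\in\tilde{A}$ put $t=\frac{s\alpha-2s(s^2-1)}{\alpha+2s^2(s^2-1)}$ and $\gamma=t^2(s-\frac1s)^2$, and send $(s,\alpha,\beta)$ to the equivalence class of a rational face cuboid $ABCD\text{-}EFGH$ with $BF=2|t|$, $EF=|t^2-1|$, $HF=\sqrt{\gamma}$ (such a cuboid exists). Then the resulting map $\tilde{A}\to\mathscr{F}$ is surjective.
   Context: For $s\in\mathbb{Q}\setminus\{0,\pm1\}$, $E_{1,s}$ is the elliptic curve $y^2=x(x-(2s)^2)(x+(s^2-1)^2)$ over $\mathbb{Q}$ and $E_{1,s}(\mathbb{Q})_{\mathrm{tor}}$ its torsion subgroup. A cuboid $ABCD\text{-}EFGH$ is a rectangular box with opposite faces $ABCD$ and $EFGH$, where $A,B,C,D$ are joined by edges to $E,F,G,H$ respectively; so the edges at $F$ are $FB,FE,FG$, $BE$ is a diagonal of face $ABFE$, $HF$ a diagonal of face $EFGH$, and $DF$ a space diagonal. A rational face cuboid is such a cuboid with $BF,EF,FG,BE,HF,DF$ all of (positive) rational length. Two rational face cuboids $ABCD\text{-}EFGH$ and $A'B'C'D'\text{-}E'F'G'H'$ are equivalent if there is a rational $\lambda$ with $BF=\lambda B'F'$, $EF=\lambda E'F'$, $GF=\lambda G'F'$.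 $\mathscr{F}$ denotes the set of equivalence classes of rational face cuboids. *)

(* Defs.v *)
From HB Require Import structures.
From mathcomp Require Import all_boot all_order all_algebra.
From mathcomp Require Import boolp classical_sets functions reals.

Set Implicit Arguments.
Unset Strict Implicit.
Unset Printing Implicit Defensive.

Import Order.TTheory GRing.Theory Num.Theory.
Local Open Scope classical_set_scope.
Local Open Scope ring_scope.

(* For a monic separable cubic f over a field of characteristic other than 2,
   the rational points of the elliptic curve y^2 = f(x), with None the point
   at infinity and the chord-and-tangent addition. *)
Section EllipticCurve.
Variables (K : fieldType) (f : {poly K}).

Definition ec_point : set (option (K * K)) :=
  [set P | if P is Some (x, y) then y ^+ 2 = f.[x] else True].

(* The sum of two points of the curve; on other arguments it is junk. *)
Definition ec_add (P Q : option (K * K)) : option (K * K) :=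
  match P, Q with
  | None, _ => Q
  | _, None => P
  | Some (x1, y1), Some (x2, y2) =>
      if (x1 == x2) && (y1 == - y2) then None
      else
        let l := if x1 == x2 then f^`().[x1] / (2 * y1)
                 else (y2 - y1) / (x2 - x1) in
        let x3 := l ^+ 2 - f`_2 - x1 - x2 in
        Some (x3, l * (x1 - x3) - y1)
  end.

Definition ec_mul (n : nat) (P : option (K * K)) : option (K * K) :=
  iter n (ec_add P) None.

Definition ec_torsion : set (option (K * K)) :=
  [set P | ec_point P /\ exists2 n : nat, (0 < n)%N & ec_mul n P = None].

End EllipticCurve.

Definition E1 (s : rat) : {poly rat} :=
  'X * ('X - ((2 * s) ^+ 2)%:P) * ('X + ((s ^+ 2 - 1) ^+ 2)%:P).

Definition tildeA : set (rat * rat * rat) :=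
  [set p | let: (s, alpha, beta) := p in
    [/\ s != 0, s != 1, s != -1 &
        (ec_point (E1 s) `\` ec_torsion (E1 s)) (Some (alpha, beta))]].

Definition t_of (s alpha : rat) : rat :=
  (s * alpha - 2 * s * (s ^+ 2 - 1)) / (alpha + 2 * s ^+ 2 * (s ^+ 2 - 1)).

Definition gamma_of (s alpha : rat) : rat :=
  t_of s alpha ^+ 2 * (s - 1 / s) ^+ 2.

Section Cuboids.
Variable R : realType.

Definition dotp (u v : 'rV[R]_3) : R := \sum_(i < 3) u 0 i * v 0 i.

Definition dist (P Q : 'rV[R]_3) : R := Num.sqrt (dotp (P - Q) (P - Q)).

(* A cuboid ABCD-EFGH in Euclidean 3-space is given by its vertex F and the
   three vertices B, E, G adjacent to F; the other four are determined. *)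
Record cuboid := Cuboid {
  vF : 'rV[R]_3;
  vB : 'rV[R]_3;
  vE : 'rV[R]_3;
  vG : 'rV[R]_3;
  vB_neqF : vB != vF;
  vE_neqF : vE != vF;
  vG_neqF : vG != vF;
  FB_orth_FE : dotp (vB - vF) (vE - vF) = 0;
  FB_orth_FG : dotp (vB - vF) (vG - vF) = 0;
  FE_orth_FG : dotp (vE - vF) (vG - vF) = 0
}.

Definition vA (K : cuboid) := vB K + (vE K - vF K).
Definition vC (K : cuboid) := vB K + (vG K - vF K).
Definition vH (K : cuboid) := vE K + (vG K - vF K).
Definition vD (K : cuboid) := vB K + (vE K - vF K) + (vG K - vF K).

Definition BF (K : cuboid) := dist (vB K) (vF K).
Definition EF (K : cuboid) := dist (vE K) (vF K).
Definition FG (K : cuboid) := dist (vF K) (vG K).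
Definition BE (K : cuboid) := dist (vB K) (vE K).
Definition HF (K : cuboid) := dist (vH K) (vF K).
Definition DF (K : cuboid) := dist (vD K) (vF K).

Definition rational (x : R) : Prop := exists q : rat, x = ratr q.

Definition rational_face_cuboid : set cuboid :=
  [set K | [/\ rational (BF K), rational (EF K) & rational (FG K)] /\
           [/\ rational (BE K), rational (HF K) & rational (DF K)]].

Definition cuboid_equiv (K K' : cuboid) : Prop :=
  exists l : rat, [/\ BF K = ratr l * BF K', EF K = ratr l * EF K'
                    & FG K = ratr l * FG K'].

Definition cuboid_class (K : cuboid) : set cuboid :=
  [set K' | rational_face_cuboid K' /\ cuboid_equiv K K'].

Definition face_classes : set (set cuboid) :=
  [set cuboid_class K | K in rational_face_cuboid].

Definition attached_cuboid (s alpha : rat) : set cuboid :=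
  [set K | let t := t_of s alpha in
    [/\ rational_face_cuboid K,
        BF K = ratr (2 * `|t|),
        EF K = ratr `|t ^+ 2 - 1|
      & HF K = Num.sqrt (ratr (gamma_of s alpha))]].

End Cuboids.

Arguments face_classes : clear implicits.

(* Main.v *)
Require Import Defs.
From HB Require Import structures.
From mathcomp Require Import all_boot all_order all_algebra.
From mathcomp Require Import boolp classical_sets functions reals.
From mathcomp Require Import ring zify.
From mathcomp Require cyclic.

(** A face cuboid amounts to (s, t, g) with g^2 = t^2 (s - 1/s)^2 - (t^2 - 1)^2
    and t, t^2 - 1, g nonzero, and (t, g) corresponds to a point (alpha, beta)
    of E_{1,s} by g = 2 (s^4 - 1) beta / (alpha + 2 s^2 (s^2 - 1))^2.  The
    degenerate (t, g) correspond to a torsion subgroup Z/2 x Z/4, so everything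
    rests on showing that E_{1,s}(Q) has no other torsion.

    Put A = 2s, B = s^2 - 1, C = s^2 + 1, so A^2 + B^2 = C^2 and E_{1,s} is
    y^2 = x (x - A^2) (x + B^2).  A torsion point has a preperiodic orbit under
    doubling.  If the orbit reaches O, a point of order 8 would make A C a
    square up to sign, where C^2 - A^2 = B^2, contradicting Fermat's theorem on
    x^4 - y^4 = z^2.
    Otherwise there is a periodic orbit; there x = u^2, x - A^2 = v^2 and
    x + B^2 = w^2, and the valuations of u, v, w along the cycle force one of
    u v, u w, v w to be a square up to sign.  As u^2 - v^2 = A^2,
    w^2 - u^2 = B^2 and w^2 - v^2 = C^2, Fermat's theorem applies again. *)

Set Implicit Arguments.
Unset Strict Implicit.
Unset Printing Implicit Defensive.

Import Order.TTheory GRing.Theory Num.Theory.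
Local Open Scope ring_scope.

(** * Fermat's theorem on x^4 - y^4 = z^2 *)

Section FermatQuartic.
Local Open Scope nat_scope.

Lemma sqrn_of_logn n : 0 < n -> (forall p, prime p -> ~~ odd (logn p n)) ->
  exists m, n = m ^ 2.
Proof.
move=> n0 ev; exists (\prod_(p <- primes n) p ^ (logn p n)./2).
rewrite {1}(prod_prime_decomp n0) prime_decompE big_map /=.
rewrite -mulnn -big_split /=; apply: eq_big_seq => p.
rewrite mem_primes => /and3P[pp _ _].
by rewrite -expnD addnn -[in LHS](odd_double_half (logn p n)) (negPf (ev p pp)).
Qed.

(** A prime dividing [a] does not divide [b], so its exponent in [a] is its exponent in [c ^ 2]. *)
Lemma coprime_mul_sqrn a b c : 0 < a -> coprime a b -> a * b = c ^ 2 ->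
  exists d, a = d ^ 2.
Proof.
move=> a0 cab abc; have [b0|b0] := posnP b.
  by exists 1; move: cab; rewrite b0 /coprime gcdn0 => /eqP ->.
apply: sqrn_of_logn => // p pp; case la: (logn p a) => [//|k].
have pa : p %| a by rewrite -[p]expn1 pfactor_dvdn // la.
have := congr1 (logn p) abc; rewrite lognM // lognX la.
suff -> : logn p b = 0 by lia.
apply/eqP; rewrite -leqn0 leqNgt; apply/negP => lb.
have pb : p %| b by rewrite -[p]expn1 pfactor_dvdn.
have : p %| gcdn a b by rewrite dvdn_gcd pa.
by rewrite (eqP cab) dvdn1 => /eqP p1; rewrite p1 in pp.
Qed.

Lemma odd_sqr n : odd (n ^ 2) = odd n.
Proof. by rewrite oddX. Qed.

(** Here [a] and [c] are odd, and [(c + a)/2], [(c - a)/2] are coprime with product [(b/2)^2], so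
    each is a square. The equation for [a] is additive to avoid truncated subtraction. *)
Lemma pythagorean_param a b c : coprime a b -> ~~ odd b -> 0 < b ->
  a ^ 2 + b ^ 2 = c ^ 2 ->
  exists g h, [/\ coprime g h, a + h ^ 2 = g ^ 2, b = 2 * (g * h) & c = g ^ 2 + h ^ 2].
Proof.
move=> cab evb b0 e.
have oa : odd a.
  apply: contraLR cab => eva; rewrite /coprime; apply/eqP => g1.
  have : 2 %| gcdn a b by rewrite dvdn_gcd !dvdn2 eva evb.
  by rewrite g1.
have oc : odd c by rewrite -odd_sqr -e oddD !odd_sqr oa (negPf evb).
have ac : a < c.
  rewrite -(ltn_exp2r _ _ (isT : 0 < 2)) -e -{1}[a ^ 2]addn0 ltn_add2l.
  by rewrite expn_gt0 b0.
pose p := (c + a)./2; pose q := (c - a)./2.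
have pE : c + a = p.*2 by rewrite /p -[LHS]odd_double_half oddD oc oa.
have qE : c - a = q.*2 by rewrite /q -[LHS]odd_double_half oddB ?(ltnW ac) // oc oa.
have bE : b = b./2.*2 by rewrite -[LHS]odd_double_half (negPf evb).
have cE : c = p + q by lia.
have aE : a + q = p by lia.
have pq : p * q = b./2 ^ 2.
  have : 4 * (p * q) = 4 * b./2 ^ 2 by nia.
  by move/eqP; rewrite eqn_pmul2l // => /eqP.
have cpq : coprime p q.
  rewrite /coprime -dvdn1 -(eqP cab); set g := gcdn p q.
  have gp : g %| p := dvdn_gcdl _ _; have gq : g %| q := dvdn_gcdr _ _.
  rewrite dvdn_gcd; have -> /= : g %| a.
    by rewrite -(dvdn_addl _ gq) aE.
  apply: (@dvdn_trans b./2); last by rewrite [X in _ %| X]bE -muln2 dvdn_mulr.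
  by rewrite -(@dvdn_pexp2r _ _ 2) // -pq -mulnn dvdn_mul.
have q0 : 0 < q by lia.
have p0 : 0 < p by lia.
have [g gE] := coprime_mul_sqrn p0 cpq pq.
have [h hE] : exists d, q = d ^ 2.
  by apply: (@coprime_mul_sqrn q p b./2); rewrite // 1?coprime_sym // mulnC.
exists g, h; rewrite -gE -hE; split=> //.
  by rewrite -(@coprime_pexpl 2) // -(@coprime_pexpr 2) // -gE -hE.
rewrite bE -mul2n; congr (2 * _).
by apply/eqP; rewrite -(@eqn_exp2r _ _ 2) // -pq expnMn -gE -hE.
Qed.

(** Infinite descent on [x]: parametrising the primitive Pythagorean triple [(z, y^2, x^2)] yields a
    smaller solution, at once if [y] is odd and after a second parametrisation if [y] is even. *)
Lemma fermat_quartic_coprime x y z : 0 < y -> 0 < z -> coprime x y ->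
  x ^ 4 <> y ^ 4 + z ^ 2.
Proof.
have [n] := ubnP x; elim: n x y z => // n IHn x y z xn y0 z0 cxy e.
have x0 : 0 < x by case: x e {xn cxy} => // /esym/eqP; rewrite exp0n // addn_eq0 !expn_eq0; lia.
have e' : z ^ 2 + (y ^ 2) ^ 2 = (x ^ 2) ^ 2 by rewrite -!expnM addnC -e.
have czy : coprime z (y ^ 2).
  rewrite -(@coprime_pexpl 2) // -(@coprime_pexpr 2) //.
  have : coprime ((x ^ 2) ^ 2) ((y ^ 2) ^ 2).
    by rewrite !(coprime_pexpl, coprime_pexpr).
  by rewrite -e' /coprime gcdnC gcdnDr gcdnC.
(* For odd [y], [y^2 = p^2 - q^2] and [x^2 = p^2 + q^2], so [p^4 - q^4 = (x y)^2]. *)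
have [oy|evy] := boolP (odd y).
  have [||//||p [q [cpq e1 e2 e3]]] := @pythagorean_param (y ^ 2) z (x ^ 2).
  - by rewrite coprime_sym.
  - have [oz|//] := boolP (odd z); exfalso.
    have : (z ^ 2 + (y ^ 2) ^ 2) %% 4 = (x ^ 2) ^ 2 %% 4 by rewrite e'.
    have sq m : (m ^ 2) %% 4 = odd m :> nat.
      rewrite -[m in LHS]odd_double_half; case: (odd m); rewrite ?add0n ?add1n.
        by rewrite (_ : _ ^ 2 = (m./2 ^ 2 + m./2) * 4 + 1) ?modnMDl //; nia.
      by rewrite (_ : _ ^ 2 = m./2 ^ 2 * 4) ?modnMl //; nia.
    by rewrite -modnDm !sq !oddX oz oy /=; case: (odd x).
  - by rewrite addnC.
  have q0 : 0 < q by rewrite lt0n; apply: contraTneq z0 => q0; rewrite e2 q0 !muln0.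
  apply: (IHn p q (x * y)) => //.
  - rewrite -ltnS (leq_trans _ xn) // ltnS -(ltn_exp2r _ _ (isT : 0 < 2)) e3.
    by rewrite -{1}[p ^ 2]addn0 ltn_add2l expn_gt0 q0.
  - by rewrite muln_gt0 x0.
  - rewrite expnMn e3 -(addnK (q ^ 2) (y ^ 2)) e1; nia.
have [|||p [q [cpq e1 e2 e3]]] := @pythagorean_param z (y ^ 2) (x ^ 2) czy.
- by rewrite odd_sqr.
- by rewrite expn_gt0 y0.
- exact: e'.
have pq0 : 0 < p * q by rewrite lt0n; apply: contraTneq y0 => pq0; move: e2; rewrite pq0 muln0; case: (y).
have /andP[p0 q0] : (0 < p) && (0 < q) by rewrite -muln_gt0.
(* For even [y], [y^2 = 2 p q] with one of [p], [q] even; call it [2 r] and the other [s]. Then [r]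
   and [s] are squares. Writing [r = g h] and [s = g^2 - h^2] with [g], [h] coprime gives [g = G^2],
   [h = H^2], so [G^4 - H^4 = s] is a square. *)
have core r s : 0 < r -> 0 < s -> coprime (2 * r) s -> y ^ 2 = 2 * (2 * r * s) ->
    x ^ 2 = (2 * r) ^ 2 + s ^ 2 -> False.
  move=> r0 s0 crs ey ex.
  have yE : y = y./2.*2 by rewrite -[LHS]odd_double_half (negPf evy).
  have rs : r * s = y./2 ^ 2 by nia.
  have crs' : coprime r s by move: crs; rewrite coprimeMl => /andP[].
  have [d dE] := coprime_mul_sqrn r0 crs' rs.
  have [f fE] : exists d, s = d ^ 2.
    by apply: (@coprime_mul_sqrn s r y./2); rewrite // 1?coprime_sym // mulnC.
  have [||||g [h [cgh g1 g2 g3]]] := @pythagorean_param s (2 * r) x.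
  - by rewrite coprime_sym.
  - by rewrite oddM.
  - by rewrite muln_gt0.
  - by rewrite addnC -ex.
  have ghd : g * h = d ^ 2 by rewrite -dE; lia.
  have gh0 : 0 < g * h by rewrite ghd -dE.
  have /andP[g0 h0] : (0 < g) && (0 < h) by rewrite -muln_gt0.
  have [G GE] := coprime_mul_sqrn g0 cgh ghd.
  have [H HE] : exists d, h = d ^ 2.
    by apply: (@coprime_mul_sqrn h g d); rewrite // 1?coprime_sym // mulnC.
  have G0 : 0 < G by case: G GE g0 => // ->.
  have H0 : 0 < H by case: H HE h0 => // ->.
  apply: (IHn G H f) => //.
  - rewrite -ltnS (leq_trans _ xn) // ltnS g3.
    apply: (@leq_ltn_trans (g ^ 2)); last by rewrite -{1}[g ^ 2]addn0 ltn_add2l expn_gt0 h0.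
    by rewrite GE -expnM -[leqLHS]expn1 leq_pexp2l.
  - by case: f fE s0 => // ->.
  - by move: cgh; rewrite GE HE !(coprime_pexpl, coprime_pexpr).
  - by rewrite -fE !(expnM _ 2 2) -GE -HE addnC -g1.
have oz : odd z.
  apply: contraLR czy => evz; rewrite /coprime; apply/eqP => g1.
  have : 2 %| gcdn z (y ^ 2) by rewrite dvdn_gcd !dvdn2 odd_sqr evz evy.
  by rewrite g1.
have opq : odd p = ~~ odd q.
  by move: (congr1 odd e1); rewrite oddD !odd_sqr oz /= => ->.
have [oq|evq] := boolP (odd q).
  have pE : p = 2 * p./2 by rewrite -[LHS]odd_double_half opq oq -mul2n.
  apply: (core p./2 q) => //; rewrite -?pE //; last by rewrite pE in p0; lia.
have qE : q = 2 * q./2 by rewrite -[LHS]odd_double_half (negPf evq) -mul2n.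
apply: (core q./2 p) => //; rewrite -?qE //.
- by rewrite qE in q0; lia.
- by rewrite coprime_sym.
- by rewrite e2 mulnC [p * q]mulnC mulnC.
- by rewrite addnC.
Qed.

Lemma fermat_quartic x y z : 0 < y -> 0 < z -> x ^ 4 <> y ^ 4 + z ^ 2.
Proof.
move=> y0 z0 e; have g0 : 0 < gcdn x y by rewrite gcdn_gt0 y0 orbT.
have [x' [y' [cxy ex ey]]] : exists x' y', [/\ coprime x' y', x = x' * gcdn x y & y = y' * gcdn x y].
  exists (x %/ gcdn x y), (y %/ gcdn x y).
  rewrite !divnK ?dvdn_gcdl ?dvdn_gcdr /coprime; split=> //.
  by rewrite -(eqn_pmul2r g0) muln_gcdl !divnK ?dvdn_gcdl ?dvdn_gcdr ?mul1n.
set g := gcdn x y in ex ey g0.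
(* [g^4] divides [x^4 - y^4 = z^2]. *)
have /dvdnP[z' ez] : g ^ 2 %| z.
  rewrite -(@dvdn_pexp2r _ _ 2) // -expnM -(@dvdn_addr (y ^ 4)) ?dvdn_exp2r ?dvdn_gcdr //.
  by rewrite -e dvdn_exp2r // dvdn_gcdl.
apply: (@fermat_quartic_coprime x' y' z') => //.
- by move: y0; rewrite ey muln_gt0 => /andP[].
- by move: z0; rewrite ez muln_gt0 => /andP[].
- have g4 : 0 < g ^ 4 by rewrite expn_gt0 g0.
  apply/eqP; rewrite -(eqn_pmul2r g4) mulnDl -!expnMn -ex -ey e; apply/eqP; congr addn.
  by rewrite ez expnMn -expnM.
Qed.

End FermatQuartic.


Lemma fermat_quartic_rat (r t : rat) : r != 0 -> t != 0 -> r ^+ 4 - 1 != t ^+ 2.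
Proof.
move=> r0 t0; apply/eqP => e.
have rE := divq_num_den r; have tE := divq_num_den t.
have dr := denq_neq0 r; have dt := denq_neq0 t.
have nr : numq r != 0 by rewrite numq_eq0.
have nt : numq t != 0 by rewrite numq_eq0.
(* The equation is multiplied by the fourth power of [denq r * denq t]. *)
apply: (@fermat_quartic `|numq r * denq t| `|denq r * denq t| `|numq t * denq t * denq r ^+ 2|).
- by rewrite absz_gt0 mulf_neq0.
- by rewrite absz_gt0 !mulf_neq0 ?expf_neq0.
have sq n k : (`|n|%N%:R : rat) ^+ k.*2 = n%:~R ^+ k.*2.
  by rewrite natr_absz intr_norm -mul2n !exprM -normrX ger0_norm ?sqr_ge0.
apply/eqP; rewrite -(eqr_nat rat) natrD !natrX (sq _ 2%N) (sq _ 2%N) (sq _ 1%N).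
rewrite /= !rmorphM /= !numqE.
move: (denq r)%:~R (denq t)%:~R => d d'.
rewrite -subr_eq0; apply/eqP.
transitivity ((d * d') ^+ 4 * (r ^+ 4 - 1 - t ^+ 2)); first by ring.
by rewrite e subrr mulr0.
Qed.

(** * Valuations along a doubling cycle *)

(** The ultrametric triangle condition: the minimum of the three is attained at least twice. The
    disjunctive form is what [lia] can use. *)
Definition isosceles (a b c : int) :=
  [&& (a <= c) || (b <= c), (a <= b) || (c <= b) & (b <= a) || (c <= a)].

Lemma isosceles_rot a b c : isosceles a b c = isosceles b c a.
Proof. by rewrite /isosceles; lia. Qed.

Section Valuation.
Variable p : nat.
Hypothesis p_pr : prime p.

(* The value at 0 is junk. *)
Definition pval (x : rat) : int :=
  (logn p `|numq x|)%:Z - (logn p `|denq x|)%:Z.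

Lemma pval_frac (n d : int) : n != 0 -> d != 0 ->
  pval (n%:~R / d%:~R) = (logn p `|n|)%:Z - (logn p `|d|)%:Z.
Proof.
move=> n0 d0; set x := (_ / _ : rat).
have x0 : numq x != 0 by rewrite numq_eq0 mulf_neq0 ?invr_eq0 ?intr_eq0.
have e : numq x * d = n * denq x.
  apply: (intr_inj (R := rat)); rewrite !rmorphM /= numqE mulrAC.
  by rewrite {1}/x divfK ?intr_eq0.
have := congr1 (fun z => logn p `|z|) e.
rewrite !abszM !lognM ?absz_gt0 ?denq_neq0 // /pval; lia.
Qed.

Lemma pvalM x y : x != 0 -> y != 0 -> pval (x * y) = pval x + pval y.
Proof.
move=> x0 y0; rewrite -{1}[x]divq_num_den -{1}[y]divq_num_den mulf_div -!intrM.
rewrite pval_frac ?mulf_neq0 ?numq_eq0 ?denq_neq0 // !abszM.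
by rewrite !lognM ?absz_gt0 ?numq_eq0 ?denq_neq0 // /pval; lia.
Qed.

Lemma pval_sqr x : x != 0 -> pval (x ^+ 2) = 2 * pval x.
Proof. by move=> x0; rewrite expr2 pvalM // mulr2n mulrDl mul1r. Qed.

Lemma pvalN x : pval (- x) = pval x.
Proof. by rewrite /pval numqN denqN abszN. Qed.

Lemma pval_nat n : (0 < n)%N -> pval n%:R = logn p n.
Proof.
by move=> n0; rewrite /pval -[n%:R]/(n%:Z%:~R) numq_int denq_int /= logn1 subr0.
Qed.

Lemma pvalD x y : x != 0 -> y != 0 -> x + y != 0 ->
  (pval x <= pval (x + y)) || (pval y <= pval (x + y)).
Proof.
move=> x0 y0.
have -> : x + y = (numq x * denq y + numq y * denq x)%:~R / (denq x * denq y)%:~R.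
  rewrite -{1}[x]divq_num_den -{1}[y]divq_num_den.
  by rewrite addf_div ?intr_eq0 ?denq_neq0 // -!intrM -intrD.
move=> s0; rewrite pval_frac ?mulf_neq0 ?denq_neq0 //; last first.
  by apply: contra_neq s0 => ->; rewrite mul0r.
rewrite /pval; have := numq_eq0 x; have := numq_eq0 y.
have : numq x * denq y + numq y * denq x != 0.
  by apply: contra_neq s0 => ->; rewrite mul0r.
rewrite (negPf x0) (negPf y0); move: (denq_neq0 x) (denq_neq0 y).
move: (denq x) (denq y) (numq x) (numq y) => d e n m d0 e0 s1 /negbT m0 /negbT n0.
rewrite abszM lognM ?absz_gt0 //.
set a := logn p `|n|; set b := logn p `|m|.
set c := logn p `|d|; set g := logn p `|e|.
suff : (minn (a + g) (b + c) <= logn p `|(n * e + m * d)%R|)%N by lia.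
rewrite -pfactor_dvdn ?absz_gt0 //.
suff : ((p ^ minn (a + g) (b + c))%N%:Z %| n * e + m * d)%Z by [].
apply: rpredD; rewrite dvdzE /= pfactor_dvdn ?absz_gt0 ?mulf_neq0 //.
  by rewrite abszM lognM ?absz_gt0 // geq_minl.
by rewrite abszM lognM ?absz_gt0 // geq_minr.
Qed.

Lemma pval_isosceles x y z : x != 0 -> y != 0 -> z != 0 -> x + y = z ->
  isosceles (pval x) (pval y) (pval z).
Proof.
move=> x0 y0 z0 e; apply/and3P; split.
- by rewrite -e pvalD // e.
- have ey : - x + z = y by rewrite -e addKr.
  by have := @pvalD (- x) z; rewrite ey pvalN => -> //; rewrite oppr_eq0.
- have ex : - y + z = x by rewrite -e addrC addrK.
  by have := @pvalD (- y) z; rewrite ex pvalN => -> //; rewrite oppr_eq0.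
Qed.
End Valuation.

(** The product of [|numq x|] and [|denq x|] has at each prime the valuation parity of [x], so it is
    a square [m^2], and [|x| = (m / denq x)^2]. *)
Lemma rat_sqr_of_pval (x : rat) : x != 0 ->
  (forall p, prime p -> exists k, pval p x = 2 * k) ->
  exists r : rat, x = r ^+ 2 \/ x = - r ^+ 2.
Proof.
move=> x0 ev; set n := (`|numq x| * `|denq x|)%N.
have n0 : (0 < n)%N by rewrite muln_gt0 !absz_gt0 numq_eq0 x0 denq_neq0.
have [p pp|m em] := sqrn_of_logn n0.
  have [k] := ev p pp; rewrite /n lognM ?absz_gt0 ?numq_eq0 ?denq_neq0 // /pval.
  lia.
exists (m%:R / (denq x)%:~R).
have d0 : (denq x)%:~R != 0 :> rat by rewrite intr_eq0 denq_neq0.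
have : (m%:R : rat) ^+ 2 = `|x| * (denq x)%:~R ^+ 2.
  rewrite -natrX -em /n natrM !natr_absz.
  by rewrite !intr_norm numqE normrM -mulrA -expr2 real_normK ?num_real.
rewrite expr_div_n => ->; rewrite mulfK ?expf_neq0 //.
by case: (ger0P x) => _; [left|right; rewrite opprK].
Qed.

(* Y, Z, W, S, T, U, V stand for the valuations of y, z, w, y + z, y - z,
   y + w, z + w, and e, m for half those of y^2 - z^2 and of y^2 - w^2,
   z^2 - w^2.  A value below m can never be left again; otherwise W = m, and
   d = Y - m = Z - m evolves by d' = min (2 d, 2 (e - m - d)) unless
   2 d = e - m, in which case it runs into the fixed value 0. *)
Lemma orbit_valuations (Y Z W S T U V : nat -> int) (e m : int) (k : nat) :
  (0 < k)%N -> m <= e ->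
  (forall i, [/\ Y (i + k)%N = Y i, Z (i + k)%N = Z i & W (i + k)%N = W i]) ->
  (forall i, [&& isosceles (2 * e) (2 * Z i) (2 * Y i),
     isosceles (2 * m) (2 * W i) (2 * Y i) &
     isosceles (2 * m) (2 * W i) (2 * Z i)]) ->
  (forall i, [&& S i.+1 == Y i + Z i - W i, S i.+1 + T i.+1 == 2 * e,
     U i.+1 == Y i + W i - Z i & V i.+1 == Z i + W i - Y i]) ->
  (forall i, [&& isosceles (S i) (Y i) (Z i), isosceles (T i) (Y i) (Z i),
     isosceles (U i) (Y i) (W i) & isosceles (V i) (Z i) (W i)]) ->
  Y 0%N = Z 0%N /\
  ((forall i, isosceles (S i) (T i) (Y i)) -> exists j, Y 0%N = W 0%N + 2 * j).
Proof.
move=> k0 me per H1 H2 H3.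
have perM j n : [/\ Y (j + n * k)%N = Y j, Z (j + n * k)%N = Z j & W (j + n * k)%N = W j].
  elim: n => [|n [IH1 IH2 IH3]]; first by rewrite mul0n addn0.
  by rewrite mulSnr addnA; have [-> -> ->] := per (j + n * k)%N.
(* A property that passes to successors reaches a multiple of the period, where the values are those
   at 0. *)
have back (Q : nat -> Prop) i : (forall j, Q j -> Q j.+1) -> Q i -> Q (i * k)%N.
  move=> Qs Qi; rewrite -(subnK (leq_pmulr i k0)).
  by elim: (_ - _)%N => //= n IH; rewrite addSn; apply: Qs.
have low i : W i < m -> (Y i == W i) && (Z i == W i).
  by move: (H1 i); rewrite /isosceles; lia.
have [W0|W0] := ltP (W 0%N) m; first by move: (low _ W0); split; [lia|exists 0; lia].
have Wlow i : (Y i < m) || (Z i < m) -> W i < m.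
  by move: (H1 i); rewrite /isosceles; lia.
(* If [W i < m], then [Y i = Z i = W i] and [S i.+1 = W i < m], so [Y] or [Z], hence also [W], is
   below [m] at [i.+1]; the cycle carries this to index 0. *)
have Wge i : m <= W i.
  rewrite leNgt; apply/negP => Wi; move: W0; rewrite leNgt => /negP[].
  have [_ _ <-] := perM 0%N i; rewrite add0n.
  apply: (back (fun j => W j < m)) => // j Wj; apply: Wlow.
  have /and4P[+ _ _ _] := H2 j; have /and4P[+ _ _ _] := H3 j.+1.
  by move: (low j Wj); rewrite /isosceles; lia.
have YZge i : (m <= Y i) && (m <= Z i) by move: (Wge i) (Wlow i); lia.
(* [W i > m] would give [Y i = Z i = m] and [S i.+1 < m], forcing [Y] or [Z] below [m] at [i.+1]. *)
have Wm i : W i = m.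
  apply/eqP; apply: contraT => nm.
  have /and4P[+ _ _ _] := H2 i; have /and4P[+ _ _ _] := H3 i.+1.
  by move: (Wge i) (H1 i) (YZge i) (YZge i.+1); rewrite /isosceles; lia.
(* If [Y i] and [Z i] differed, [U i.+1] or [V i.+1] would be below [m] and a strict minimum. *)
have YZ i : Y i = Z i.
  have /and4P[_ _ + +] := H2 i; have /and4P[_ _ + +] := H3 i.+1.
  by move: (Wm i) (YZge i) (YZge i.+1) (Wm i.+1); rewrite /isosceles; lia.
split=> // odd_p.
have [d dE] : exists d, forall i, Y i = d i + m by exists (fun i => Y i - m) => i; rewrite subrK.
have dge i : 0 <= d i by move: (YZge i) (dE i); lia.
have ST i : (S i.+1 == 2 * d i + m) && (T i.+1 == 2 * (e - m - d i) + m).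
  have /and4P[+ + _ _] := H2 i.
  by move: (YZ i) (Wm i) (dE i); lia.
have dle i : d i <= e - m.
  have /and4P[_ + _ _] := H3 i.+1.
  by move: (ST i) (YZge i.+1); rewrite /isosceles; lia.
have step i : isosceles (2 * d i) (2 * (e - m - d i)) (d i.+1).
  by move: (odd_p i.+1) (ST i) (dE i.+1); rewrite /isosceles; lia.
have per_d n i : d (i + n * k)%N = d i.
  by have [+ _ _] := perM i n; move: (dE i) (dE (i + n * k)%N); lia.
(* Index [l] precedes 0 in the cycle, so [d 0] is read off from [d l]. *)
have kE := prednK k0; set l := k.-1 in kE.
have dl1 : d l.+1 = d 0%N by rewrite -(per_d 1%N 0%N) mul1n add0n kE.
rewrite dE Wm.
have [dl|dl] := eqVneq (2 * d l) (e - m); last first.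
  have : (d l.+1 == 2 * d l) || (d l.+1 == 2 * (e - m - d l)).
    by move: (step l); rewrite /isosceles; lia.
  rewrite dl1 => /orP[] /eqP ->.
    by exists (d l); rewrite addrC.
  by exists (e - m - d l); rewrite addrC.
exists 0; rewrite mulr0 addr0 -[RHS]add0r; congr (_ + _).
have d1 : d l.+1 = e - m by move: (step l) (dle l.+1); rewrite /isosceles; lia.
have d2 : d l.+2 = 0.
  by move: (step l.+1) (dge l.+2) (dle l.+2); rewrite /isosceles; lia.
rewrite -(per_d l.+2 0%N) add0n; apply: (back (fun j => d j = 0)) => // j dj.
by move: (step j) (dge j.+1) (dle j.+1); rewrite /isosceles; lia.
Qed.

(** Up to sign, [y i.+1 + z i.+1] is [y i * z i / w i], and likewise for the other pairs; with
    [(y + z) (y - z) = a] this gives the linear relations of [orbit_valuations]. Its last hypothesis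
    comes from [(y + z) + (y - z) = 2 y], where 2 must be a [p]-adic unit. *)
Lemma orbit_pval p (y z w : nat -> rat) (a b c : rat) (e m : int) (k : nat) :
  prime p -> (0 < k)%N -> m <= e ->
  a != 0 -> b != 0 -> c != 0 ->
  pval p a = 2 * e -> pval p b = 2 * m -> pval p c = 2 * m ->
  (forall i, [/\ y i != 0, z i != 0 & w i != 0]) ->
  (forall i, [/\ y (i + k)%N = y i, z (i + k)%N = z i & w (i + k)%N = w i]) ->
  (forall i, [/\ y i ^+ 2 = a + z i ^+ 2, y i ^+ 2 = b + w i ^+ 2 &
     z i ^+ 2 = c + w i ^+ 2]) ->
  (forall i, [/\ ((y i.+1 + z i.+1) * w i) ^+ 2 = (y i * z i) ^+ 2,
     ((y i.+1 + w i.+1) * z i) ^+ 2 = (y i * w i) ^+ 2 &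
     ((z i.+1 + w i.+1) * y i) ^+ 2 = (z i * w i) ^+ 2]) ->
  pval p (y 0%N) = pval p (z 0%N) /\
  (p != 2%N -> exists j, pval p (y 0%N) = pval p (w 0%N) + 2 * j).
Proof.
move=> pp k0 me a0 b0 c0 va vb vc nz per df db.
have nzX x : x != 0 :> rat -> x ^+ 2 != 0 by move=> ?; rewrite expf_neq0.
have sums i : [/\ y i + z i != 0, y i - z i != 0, y i + w i != 0 & z i + w i != 0].
  have [ea eb ec] := df i.
  split; [move: a0|move: a0|move: b0|move: c0]; apply: contra_neq => h.
  - by apply: (addIr (z i ^+ 2)); rewrite -ea -(addrK (z i) (y i)) h; ring.
  - by apply: (addIr (z i ^+ 2)); rewrite -ea -(subrK (z i) (y i)) h; ring.
  - by apply: (addIr (w i ^+ 2)); rewrite -eb -(addrK (w i) (y i)) h; ring.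
  - by apply: (addIr (w i ^+ 2)); rewrite -ec -(addrK (w i) (z i)) h; ring.
have dbl x t r : x != 0 -> t != 0 -> r != 0 -> forall q, q != 0 ->
    (q * r) ^+ 2 = (x * t) ^+ 2 -> pval p q = pval p x + pval p t - pval p r.
  move=> x0 t0 r0 q q0 /(congr1 (pval p)).
  by rewrite !pval_sqr ?mulf_neq0 // !pvalM //; lia.
pose Y i := pval p (y i); pose Z i := pval p (z i); pose W i := pval p (w i).
pose S i := pval p (y i + z i); pose T i := pval p (y i - z i).
have [||||YZ odd_p] := @orbit_valuations Y Z W S T
  (fun i => pval p (y i + w i)) (fun i => pval p (z i + w i)) e m k k0 me.
- by move=> i; rewrite /Y /Z /W; have [-> -> ->] := per i.
- move=> i; have [y0 z0 w0] := nz i; have [ea eb ec] := df i.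
  apply/and3P; split; [rewrite -va|rewrite -vb|rewrite -vc];
    by rewrite -!pval_sqr //; apply: pval_isosceles; rewrite ?nzX.
- move=> i; have [y0 z0 w0] := nz i; have [d1 d2 d3] := db i.
  have [s1 s2 s3 s4] := sums i.+1.
  apply/and4P; split; [|rewrite -va|..]; apply/eqP; try exact: dbl.
  rewrite /S /T -pvalM //; congr (pval p _).
  by have [ea _ _] := df i.+1; rewrite -(addrK (z i.+1 ^+ 2) a) -ea; ring.
- move=> i; have [y0 z0 w0] := nz i; have [s1 s2 s3 s4] := sums i.
  apply/and4P; split; rewrite isosceles_rot; try exact: pval_isosceles.
  by rewrite /Z -(pvalN _ (z i)); apply: pval_isosceles; rewrite ?oppr_eq0.
split=> // p2; apply: odd_p => i.
have [y0 z0 w0] := nz i; have [s1 s2 s3 s4] := sums i.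
have v2 : pval p 2 = 0.
  by rewrite pval_nat // logn_prime // (negPf p2).
rewrite /Y -[pval p (y i)]add0r -v2 -pvalM //.
by apply: pval_isosceles => //; rewrite ?mulf_neq0 //; ring.
Qed.

(** Up to sign [x y] is [r^2], so dividing the first equation by [y^2] gives
    [(r / y)^4 - 1 = (d / y)^2]. *)
Lemma fermat_pair (x y d r : rat) : x != 0 -> y != 0 -> d != 0 ->
  x ^+ 2 - y ^+ 2 = d ^+ 2 -> (x * y) ^+ 2 = r ^+ 4 -> False.
Proof.
move=> x0 y0 d0 e xy; have r0 : r != 0.
  apply/eqP => r0; move/eqP: xy.
  by rewrite r0 expr0n expf_eq0 /= mulf_eq0 (negPf x0) (negPf y0).
have /eqP[] : (r / y) ^+ 4 - 1 != (d / y) ^+ 2.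
  by apply: fermat_quartic_rat; rewrite mulf_neq0 ?invr_eq0.
by rewrite !expr_div_n -xy -e; field.
Qed.

Definition even_int (x : int) := exists j, x = 2 * j.

Lemma sqr_square_of_pval (x y : rat) : x != 0 -> y != 0 ->
  (forall p, prime p -> even_int (pval p x + pval p y)) ->
  exists r : rat, (x * y) ^+ 2 = r ^+ 4.
Proof.
move=> x0 y0 ev; have [|p pp|r hr] := @rat_sqr_of_pval (x * y).
- by rewrite mulf_neq0.
- by have [j jE] := ev p pp; exists j; rewrite pvalM.
by exists r; rewrite (exprM _ 2 2); case: hr => ->; rewrite ?sqrrN.
Qed.

Lemma no_doubling_cycle (A B C : rat) (u v w : nat -> rat) (k : nat) :
  (0 < k)%N -> A != 0 -> B != 0 -> C != 0 -> A ^+ 2 + B ^+ 2 = C ^+ 2 ->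
  (forall i, [/\ u i != 0, v i != 0 & w i != 0]) ->
  (forall i, [/\ u (i + k)%N = u i, v (i + k)%N = v i & w (i + k)%N = w i]) ->
  (forall i, v i ^+ 2 = u i ^+ 2 - A ^+ 2 /\ w i ^+ 2 = u i ^+ 2 + B ^+ 2) ->
  (forall i, [/\ ((u i.+1 + v i.+1) * w i) ^+ 2 = (u i * v i) ^+ 2,
     ((u i.+1 + w i.+1) * v i) ^+ 2 = (u i * w i) ^+ 2 &
     ((v i.+1 + w i.+1) * u i) ^+ 2 = (v i * w i) ^+ 2]) -> False.
Proof.
move=> k0 A0 B0 C0 ABC nz per df db.
have local p : prime p ->
  let x := pval p (u 0%N) in let y := pval p (v 0%N) in let z := pval p (w 0%N) in
  [\/ x = y, x = z | y = z] /\
  (p != 2%N -> [/\ even_int (x + y), even_int (x + z) & even_int (y + z)]).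
  move=> pp x y z.
  have sq0 t : t != 0 -> t ^+ 2 != 0 :> rat by move=> t0; rewrite expf_neq0.
  have nsq0 t : t != 0 -> - t ^+ 2 != 0 :> rat by move=> t0; rewrite oppr_eq0 sq0.
  have := pval_isosceles pp (sq0 _ A0) (sq0 _ B0) (sq0 _ C0) ABC.
  rewrite /isosceles !pval_sqr // => iso.
  (* In [orbit_pval] the roles of [y] and [z] go to the pair whose squares differ by the one of
     [A^2], [B^2], [C^2] of largest valuation. *)
  have [h|h|h] : [\/ pval p B = pval p C /\ pval p B <= pval p A,
      pval p A = pval p C /\ pval p A <= pval p B |
      pval p A = pval p B /\ pval p A <= pval p C].
    have [|] := eqVneq (pval p B) (pval p C); first by constructor 1; lia.
    have [|] := eqVneq (pval p A) (pval p C); first by constructor 2; lia.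
    by constructor 3; lia.
  - have [e1 e2] : x = y /\ (p != 2%N -> exists j, x = z + 2 * j).
      apply: (orbit_pval pp k0 h.2 (sq0 _ A0) (nsq0 _ B0) (nsq0 _ C0));
        rewrite ?pvalN ?pval_sqr ?h.1 //.
      by move=> i; have [-> ->] := df i; rewrite -ABC; split; ring.
    split=> [|/e2[j] ej]; first by constructor 1.
    by split; [exists x|exists (z + j)|exists (z + j)]; rewrite -?e1 ?ej; ring.
  - have [e1 e2] : x = z /\ (p != 2%N -> exists j, x = y + 2 * j).
      apply: (orbit_pval pp k0 h.2 (nsq0 _ B0) (sq0 _ A0) (sq0 _ C0));
        rewrite ?pvalN ?pval_sqr ?h.1 //.
      - by move=> i; have [? ? ?] := nz i.
      - by move=> i; have [? ? ?] := per i.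
      - by move=> i; have [-> ->] := df i; rewrite -ABC; split; ring.
      - by move=> i; have [d1 d2 d3] := db i; rewrite (addrC (w _)) (mulrC (w i) (v i)).
    split=> [|/e2[j] ej]; first by constructor 2.
    by split; [exists (y + j)|exists x|exists (y + j)]; rewrite -?e1 ?ej; ring.
  - have [e1 e2] : y = z /\ (p != 2%N -> exists j, y = x + 2 * j).
      apply: (orbit_pval pp k0 h.2 (nsq0 _ C0) (nsq0 _ A0) (sq0 _ B0));
        rewrite ?pvalN ?pval_sqr ?h.1 //.
      - by move=> i; have [? ? ?] := nz i.
      - by move=> i; have [? ? ?] := per i.
      - by move=> i; have [-> ->] := df i; rewrite -ABC; split; ring.
      - move=> i; have [d1 d2 d3] := db i.
        by rewrite !(addrC _ (u _)) ![_ * u i]mulrC (mulrC (u i) (_ + _)) d3 d1 d2.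
    split=> [|/e2[j] ej]; first by constructor 3.
    by split; [exists (x + j)|exists (x + j)|exists y]; rewrite -?e1 ?ej; ring.
have [u0 v0 w0] := nz 0%N; have [dv dw] := df 0%N.
have fin x y d : x != 0 -> y != 0 -> d != 0 -> x ^+ 2 - y ^+ 2 = d ^+ 2 ->
    (forall p, prime p -> even_int (pval p x + pval p y)) -> False.
  move=> x0 y0 d0 e ev; have [r hr] := sqr_square_of_pval x0 y0 ev.
  exact: fermat_pair e hr.
have eq_even (x y : int) : x = y -> even_int (x + y) by move=> ->; exists y; ring.
(* The pair with equal valuations at 2 has even total valuation there, and every pair has so at odd
   primes; Fermat's theorem is applied to this pair. *)
have [+ _] := local 2%N isT => -[] h2.
- apply: (fin _ _ _ u0 v0 A0) => [|p pp]; first by rewrite dv; ring.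
  have [->|p2] := eqVneq p 2%N; first exact: eq_even.
  by have [_ /(_ p2)[]] := local p pp.
- apply: (fin _ _ _ w0 u0 B0) => [|p pp]; first by rewrite dw; ring.
  have [->|p2] := eqVneq p 2%N; first exact: eq_even.
  by rewrite addrC; have [_ /(_ p2)[]] := local p pp.
- apply: (fin _ _ _ w0 v0 C0) => [|p pp]; first by rewrite dv dw -ABC; ring.
  have [->|p2] := eqVneq p 2%N; first exact: eq_even.
  by rewrite addrC; have [_ /(_ p2)[]] := local p pp.
Qed.

(** * The group law of a cubic *)

Section GroupLaw.
Variables (K : fieldType) (f : {poly K}).
Hypothesis f_monic : f \is monic.
Hypothesis f_size : size f = 4%N.
Hypothesis f_sep : forall x, f.[x] = 0 -> f^`().[x] != 0.
Hypothesis two_neq0 : 2 != 0 :> K.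

Let a := f`_2.
Let b := f`_1.
Let c := f`_0.

Lemma horner_cubic x : f.[x] = x ^+ 3 + a * x ^+ 2 + b * x + c.
Proof.
have f3 : f`_3 = 1 by have /monicP := f_monic; rewrite lead_coefE f_size.
rewrite horner_coef f_size !big_ord_recr big_ord0 /= f3 /a /b /c.
by ring.
Qed.

Lemma horner_deriv_cubic x : f^`().[x] = 3 * x ^+ 2 + 2 * a * x + b.
Proof.
have f3 : f`_3 = 1 by have /monicP := f_monic; rewrite lead_coefE f_size.
rewrite (@horner_coef_wide _ 3); last first.
  by have := lt_size_deriv (monic_neq0 f_monic); rewrite f_size.
rewrite !big_ord_recr big_ord0 /= !coef_deriv f3 /a /b.
by ring.
Qed.

(** Chord and tangent in one division-free condition. The first equation determines [l] when the
    abscissas differ; the second, with the difference quotient of [f] on the right, determines it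
    when [P = Q] has nonzero ordinate. *)
Definition slope (P Q : K * K) (l : K) : Prop :=
  Q.2 - P.2 = l * (Q.1 - P.1) /\
  l * (P.2 + Q.2) =
    P.1 ^+ 2 + P.1 * Q.1 + Q.1 ^+ 2 + a * (P.1 + Q.1) + b.

(** Under [slope P Q l] this is the third intersection point already reflected, hence the sum of [P]
    and [Q]. *)
Definition third (P Q : K * K) (l : K) : K * K :=
  let x := l ^+ 2 - a - P.1 - Q.1 in (x, l * (P.1 - x) - P.2).

Definition pt_opp (P : K * K) : K * K := (P.1, - P.2).

Definition ec_opp (P : option (K * K)) := omap pt_opp P.

Lemma pt_oppK : involutive pt_opp.
Proof. by case=> x y; rewrite /pt_opp opprK. Qed.

Lemma ec_oppK : involutive ec_opp.
Proof. by case=> //= P; rewrite pt_oppK. Qed.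

Lemma on_curveE (P : K * K) : ec_point f (Some P) ->
  P.2 ^+ 2 = P.1 ^+ 3 + a * P.1 ^+ 2 + b * P.1 + c.
Proof. by case: P => x y /= ->; rewrite horner_cubic. Qed.

Lemma on_curve_opp P : ec_point f P -> ec_point f (ec_opp P).
Proof. by case: P => [[x y]|] //=; rewrite sqrrN. Qed.

Lemma same_abscissa (P Q : K * K) : ec_point f (Some P) ->
  ec_point f (Some Q) -> P.1 = Q.1 -> P = Q \/ P = pt_opp Q.
Proof.
case: P Q => [x1 y1] [x2 y2] /= h1 h2 ex; rewrite ex -h2 in h1 *.
move/eqP: h1; rewrite eqf_sqr => /orP[] /eqP ->; [by left|by right].
Qed.

Lemma ec_add_opp P : ec_add f P (ec_opp P) = None.
Proof. by case: P => [[x y]|] //=; rewrite eqxx opprK eqxx. Qed.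

Lemma ec_add0 P : ec_add f P None = P.
Proof. by case: P => [[x y]|]. Qed.

Lemma ec_add_oppl P : ec_add f (ec_opp P) P = None.
Proof. by rewrite -{2}(ec_oppK P) ec_add_opp. Qed.

Lemma ec_addE (P Q : K * K) (l : K) : ec_point f (Some P) ->
  ec_point f (Some Q) -> P <> pt_opp Q -> slope P Q l ->
  ec_add f (Some P) (Some Q) = Some (third P Q l).
Proof.
case: P Q => [x1 y1] [x2 y2] hP hQ PQ [/= l1 l2].
rewrite /third /=; case: (x1 =P x2) => [ex|nx] /=; last first.
  suff -> : (y2 - y1) / (x2 - x1) = l by [].
  by rewrite l1 mulfK // subr_eq0; apply/eqP => /esym.
subst x2; case: eqP => [ey|ny]; first by case: PQ; rewrite ey.
have [[ey]|[ey]] := same_abscissa hP hQ (erefl _); last by case: ny.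
subst y2; suff -> : f^`().[x1] / (2 * y1) = l by [].
have y0 : y1 != 0 by apply: contra_notN PQ => /eqP ->; rewrite /pt_opp oppr0.
apply: (canLR (mulfK _)); first by rewrite mulf_neq0.
rewrite horner_deriv_cubic; apply/esym; rewrite (_ : l * _ = l * (y1 + y1)); last by ring.
by rewrite l2; ring.
Qed.

Lemma slope_exists (P Q : K * K) : ec_point f (Some P) ->
  ec_point f (Some Q) -> P <> pt_opp Q -> exists l, slope P Q l.
Proof.
case: P Q => [x1 y1] [x2 y2] hP hQ PQ.
have /= e1 := on_curveE hP; have /= e2 := on_curveE hQ.
case: (x1 =P x2) => [ex|/eqP nx].
  have [[_ ey]|//] := same_abscissa hP hQ ex; subst x2 y2.
  have y0 : y1 != 0 by apply: contra_notN PQ => /eqP ->; rewrite /pt_opp oppr0.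
  exists ((3 * x1 ^+ 2 + 2 * a * x1 + b) / (2 * y1)).
  by split=> /=; field; rewrite ?y0 ?two_neq0.
exists ((y2 - y1) / (x2 - x1)).
have nz : x2 - x1 != 0 by rewrite subr_eq0 eq_sym.
split=> /=; first by field.
apply: (mulIf nz); rewrite mulrAC mulfVK //.
transitivity (y2 ^+ 2 - y1 ^+ 2); first by ring.
by rewrite e1 e2; ring.
Qed.

Lemma slope_sym P Q l : slope P Q l -> slope Q P l.
Proof.
by case=> h1 h2; split; [rewrite -opprB h1|rewrite addrC h2]; ring.
Qed.

Lemma third_sym P Q l : slope P Q l -> third Q P l = third P Q l.
Proof.
case=> h1 h2; rewrite /third /=; congr (_, _); first by ring.
rewrite -[Q.2](subrK P.2) h1; ring.
Qed.

Lemma ec_addC P Q : ec_point f P -> ec_point f Q ->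
  ec_add f P Q = ec_add f Q P.
Proof.
case: P Q => [P|] [Q|] hP hQ; rewrite ?ec_add0 //.
have [PQ|PQ] := pselect (P = pt_opp Q).
  have -> : Some P = ec_opp (Some Q) by rewrite /= PQ.
  by rewrite ec_add_opp ec_add_oppl.
have QP : Q <> pt_opp P by move=> e; apply: PQ; rewrite e pt_oppK.
have [l hl] := slope_exists hP hQ PQ.
by rewrite (ec_addE hP hQ PQ hl) (ec_addE hQ hP QP (slope_sym hl)) (third_sym hl).
Qed.

(* The line of slope l through P and Q meets the curve in P, Q and a third
   point, so f - (line)^2 = (X - P.1) (X - Q.1) (X - third.1); comparing
   coefficients expresses a, b, c polynomially. *)
Lemma slope_coefs (P Q : K * K) l : ec_point f (Some P) -> slope P Q l ->
  let x3 := (third P Q l).1 in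
  [/\ a = l ^+ 2 - P.1 - Q.1 - x3,
      b = P.1 * Q.1 + P.1 * x3 + Q.1 * x3 + 2 * l * (P.2 - l * P.1) &
      c = (P.2 - l * P.1) ^+ 2 - P.1 * Q.1 * x3].
Proof.
case: P Q => [x1 y1] [x2 y2] hP [h1 h2] x3; rewrite /= in h1 h2.
have /= e := on_curveE hP.
have ea : a = l ^+ 2 - x1 - x2 - x3 by rewrite /x3 /third /=; ring.
have y2E : y2 = y1 + l * (x2 - x1) by rewrite -h1; ring.
have eb : b = x1 * x2 + x1 * x3 + x2 * x3 + 2 * l * (y1 - l * x1).
  have -> : b = l * (y1 + y2) - (x1 ^+ 2 + x1 * x2 + x2 ^+ 2 + a * (x1 + x2)).
    by rewrite h2; ring.
  by rewrite y2E ea; ring.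
split=> //.
have -> : c = y1 ^+ 2 - (x1 ^+ 3 + a * x1 ^+ 2 + b * x1) by rewrite e; ring.
by rewrite ea eb; ring.
Qed.

Lemma third_on_curve (P Q : K * K) l : ec_point f (Some P) -> slope P Q l ->
  ec_point f (Some (third P Q l)).
Proof.
move=> hP hl; have [] := slope_coefs hP hl.
rewrite /= horner_cubic.
move: (l ^+ 2 - a - P.1 - Q.1) => x3 /= ea eb ec.
by rewrite ea eb ec; ring.
Qed.

Lemma ec_add_on_curve P Q : ec_point f P -> ec_point f Q ->
  ec_point f (ec_add f P Q).
Proof.
case: P Q => [P|] [Q|] hP hQ; rewrite ?ec_add0 //.
have [PQ|PQ] := pselect (P = pt_opp Q).
  have -> : Some Q = ec_opp (Some P) by rewrite PQ /= pt_oppK.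
  by rewrite ec_add_opp.
have [l hl] := slope_exists hP hQ PQ.
by rewrite (ec_addE hP hQ PQ hl); exact: third_on_curve.
Qed.

Lemma slope_opp P Q l : slope P Q l -> slope (pt_opp P) (pt_opp Q) (- l).
Proof. by case=> h1 h2; split=> /=; [rewrite mulNr -h1|rewrite -h2]; ring. Qed.

Lemma ec_addN P Q : ec_point f P -> ec_point f Q ->
  ec_add f (ec_opp P) (ec_opp Q) = ec_opp (ec_add f P Q).
Proof.
case: P Q => [P|] [Q|] hP hQ; rewrite ?ec_add0 //.
have [PQ|PQ] := pselect (P = pt_opp Q).
  have -> : Some Q = ec_opp (Some P) by rewrite PQ /= pt_oppK.
  by rewrite !ec_add_opp.
have [l hl] := slope_exists hP hQ PQ.
rewrite (ec_addE hP hQ PQ hl) (ec_addE (on_curve_opp hP) (on_curve_opp hQ) _ (slope_opp hl)).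
  by rewrite /third /pt_opp /=; congr (Some (_, _)) => /=; ring.
by move=> /(can_inj pt_oppK).
Qed.

(** The reflected line, of slope [- l], passes through [P + Q], [- Q] and [- P]. This cancellation
    settles degenerate cases of associativity. *)
Lemma ec_addK P Q : ec_point f P -> ec_point f Q ->
  ec_add f (ec_add f P Q) (ec_opp Q) = P.
Proof.
case: P Q => [P|] [Q|] hP hQ; rewrite ?ec_add0 //; last exact: ec_add_opp.
have [PQ|PQ] := pselect (P = pt_opp Q).
  have -> : Some Q = ec_opp (Some P) by rewrite PQ /= pt_oppK.
  by rewrite ec_add_opp ec_oppK.
have [l hl] := slope_exists hP hQ PQ.
have hR := third_on_curve hP hl.
have [ea eb ec] := slope_coefs hP hl.
case: (hl) => h1 h2; have Q2 : Q.2 = P.2 + l * (Q.1 - P.1) by rewrite -h1; ring.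
rewrite (ec_addE hP hQ PQ hl).
(* If [P + Q = Q], the line contains [Q] and [- Q], so [Q] has ordinate 0 and [Q.1] is a double root
   of [f], against [f_sep]. *)
have [RQ|RQ] := pselect (third P Q l = Q).
  have y0 : Q.2 = 0.
    apply: (mulfI two_neq0); rewrite mulr0.
    transitivity (Q.2 + (third P Q l).2); first by rewrite RQ; ring.
    have -> : (third P Q l).2 = l * (P.1 - (third P Q l).1) - P.2 by [].
    by rewrite RQ Q2; ring.
  have x0 : f.[Q.1] = 0 by rewrite horner_cubic -(on_curveE hQ) y0 expr0n.
  have := f_sep x0; rewrite horner_deriv_cubic; case/eqP.
  rewrite eb ea RQ; have -> : P.2 = - l * (Q.1 - P.1).
    by apply/eqP; rewrite -subr_eq0 mulNr opprK -Q2 y0.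
  by ring.
rewrite (@ec_addE _ _ (- l)) //; last 3 first.
- exact: (on_curve_opp hQ).
- by rewrite pt_oppK.
- move: ea eb; rewrite /slope /= Q2; move: (l ^+ 2 - a - P.1 - Q.1) => x3 ea eb.
  by split; [ring|rewrite eb ea; ring].
rewrite [in RHS](surjective_pairing P) /third /=; congr (Some _).
have -> : - l * (l ^+ 2 - a - P.1 - Q.1 -
    ((- l) ^+ 2 - a - (l ^+ 2 - a - P.1 - Q.1) - Q.1)) -
    (l * (P.1 - (l ^+ 2 - a - P.1 - Q.1)) - P.2) = P.2 by ring.
by congr (_, _); ring.
Qed.

(* With x4 the abscissa of P + Q, h = R.1 - P.1 and
   e = (l + m) (R.1 - Q.1) + 2 Q.2 one has h (x4 - R.1) = (l - m) e and
   (n + l) (R.1 - x4) = e; when e = 0 the points third P Q l and R coincide and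
   the tangent equation for n is used. *)
Lemma slope_third (P Q R : K * K) l m n :
  ec_point f (Some P) -> slope P Q l -> slope Q R m ->
  slope (third P Q l) R n -> third P Q l <> pt_opp R -> P.1 != R.1 ->
  (n + l) * (m - l) = R.1 - P.1.
Proof.
case: P Q R => [x1 y1] [x2 y2] [x3 y3] hP hl [/= m1 m2] [n1 n2] opp x13.
have hS := third_on_curve hP hl.
case: (hl) => /= l1 l2; have [/= ea eb ec] := slope_coefs hP hl.
move: n1 n2 opp ea eb ec hS; rewrite /third /pt_opp /=.
move: (l ^+ 2 - a - x1 - x2) => x4 n1 n2 opp ea eb ec hS.
have h0 : x3 - x1 != 0 by rewrite subr_eq0 eq_sym.
have y1E : y1 = y2 - l * (x2 - x1) by rewrite -l1; ring.
have y3E : y3 = y2 + m * (x3 - x2) by rewrite -m1; ring.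
have key : (x3 - x1) * (x4 - x3) = (l - m) * ((l + m) * (x3 - x2) + 2 * y2).
  have : m * (y2 + y3) - (x2 ^+ 2 + x2 * x3 + x3 ^+ 2 + a * (x2 + x3) + b) = 0.
    by rewrite m2; ring.
  rewrite eb ea y3E y1E => e.
  by apply/eqP; rewrite -subr_eq0; apply/eqP; rewrite -[RHS]e; ring.
have n1' : (n + l) * (x3 - x4) = (l + m) * (x3 - x2) + 2 * y2.
  by rewrite mulrDl -n1 y3E y1E; ring.
have [e0|e0] := eqVneq ((l + m) * (x3 - x2) + 2 * y2) 0; last first.
  apply: (mulIf e0); rewrite -[in RHS]n1' -mulrA.
  transitivity (- (n + l) * ((l - m) * ((l + m) * (x3 - x2) + 2 * y2))).
    by ring.
  by rewrite -key; ring.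
have x43 : x4 = x3.
  by apply/eqP; rewrite -subr_eq0 -(mulrI_eq0 _ (mulfI h0)) key e0 mulr0.
subst x4; have y43 : l * (x1 - x3) - y1 = y3.
  by apply/esym/eqP; rewrite -subr_eq0 n1 subrr mulr0.
have y30 : 2 * y3 != 0.
  rewrite mulf_neq0 //; apply: contra_notN opp => /eqP y0.
  by rewrite y43 y0 oppr0.
apply: (mulfI y30).
have n2' : 2 * y3 * (n + l) = (x3 - x1) * (x3 - x2).
  transitivity (n * (l * (x1 - x3) - y1 + y3) + 2 * y3 * l).
    by rewrite y43; ring.
  by rewrite n2 eb ea -y43; ring.
rewrite mulrA n2' -y43 y1E; apply/eqP; rewrite -subr_eq0; apply/eqP.
have -> : 0 = (x3 - x1) * (y3 - (l * (x1 - x3) - y1)) by rewrite y43; ring.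
by rewrite y3E y1E; ring.
Qed.

Lemma ec_addVK P Q : ec_point f P -> ec_point f Q ->
  ec_add f (ec_add f P (ec_opp Q)) Q = P.
Proof.
move=> hP hQ; rewrite -{2}(ec_oppK Q); exact: (ec_addK hP (on_curve_opp hQ)).
Qed.

Lemma ec_addA_opp P Q R : ec_point f P -> ec_point f Q -> R = ec_opp (ec_add f P Q) ->
  ec_add f (ec_add f P Q) R = ec_add f P (ec_add f Q R).
Proof.
move=> hP hQ ->; have hS := ec_add_on_curve hP hQ.
rewrite ec_add_opp (ec_addC hQ (on_curve_opp hS)) -{2}(ec_oppK Q).
by rewrite (ec_addN hS (on_curve_opp hQ)) ec_addK // ec_add_opp.
Qed.

(** Degenerate positions are settled by cancellation and commutativity. Otherwise [slope_third],
    applied to [P, Q, R] and to [R, Q, P], gives [n + l = k + m] for the slopes [n], [k] of the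
    outer additions, and the two sides agree identically. *)
Lemma ec_addA P Q R : ec_point f P -> ec_point f Q -> ec_point f R ->
  ec_add f (ec_add f P Q) R = ec_add f P (ec_add f Q R).
Proof.
move=> hP hQ hR.
have hPQ := ec_add_on_curve hP hQ; have hQR := ec_add_on_curve hQ hR.
have [PNQ|PNQ] := pselect (Q = ec_opp P).
  rewrite PNQ ec_add_opp (ec_addC (on_curve_opp hP) hR).
  by rewrite (ec_addC hP) ?ec_addVK //; apply/ec_add_on_curve/on_curve_opp.
have [QNR|QNR] := pselect (R = ec_opp Q).
  by rewrite QNR ec_add_opp ec_addK // ec_add0.
have [RP|RP] := pselect (R = P).
  by rewrite RP (ec_addC (ec_add_on_curve hP hQ)) // (ec_addC hQ).
have [RNP|RNP] := pselect (R = ec_opp P).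
  rewrite RNP (ec_addC hP hQ) ec_addK // ec_addC ?ec_addVK //.
  exact/ec_add_on_curve/on_curve_opp.
have [RNPQ|RNPQ] := pselect (R = ec_opp (ec_add f P Q)); first exact: ec_addA_opp.
have [PNQR|PNQR] := pselect (P = ec_opp (ec_add f R Q)).
  by rewrite (ec_addC hPQ) // (ec_addC hP hQ) -ec_addA_opp // (ec_addC hR) // (ec_addC hP).
case: P Q R => [P|] [Q|] [R|] in hP hQ hR hPQ hQR PNQ QNR RP RNP RNPQ PNQR *; rewrite ?ec_add0 //.
have {}PNQ : P <> pt_opp Q by move=> e; apply: PNQ; rewrite e /= pt_oppK.
have {}QNR : Q <> pt_opp R by move=> e; apply: QNR; rewrite e /= pt_oppK.
have [l hl] := slope_exists hP hQ PNQ; have [m hm] := slope_exists hQ hR QNR.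
rewrite (ec_addC hR hQ) in PNQR.
rewrite (ec_addE hP hQ PNQ hl) in hPQ RNPQ *.
rewrite (ec_addE hQ hR QNR hm) in hQR PNQR *.
have {}RNPQ : third P Q l <> pt_opp R by move=> e; apply: RNPQ; rewrite e /= pt_oppK.
have {}PNQR : P <> pt_opp (third Q R m) by move=> e; apply: PNQR; rewrite e.
have [n hn] := slope_exists hPQ hR RNPQ; have [k hk] := slope_exists hP hQR PNQR.
rewrite (ec_addE hPQ hR RNPQ hn) (ec_addE hP hQR PNQR hk).
have x13 : P.1 != R.1.
  by apply/eqP => /(same_abscissa hP hR) [] e; [apply: RP|apply: RNP]; rewrite e //= pt_oppK.
have en := slope_third hP hl hm hn RNPQ x13.
have ek : (k + m) * (l - m) = P.1 - R.1.
  apply: (slope_third hR (slope_sym hm) (slope_sym hl)).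
  - by rewrite third_sym //; exact: slope_sym.
  - by rewrite third_sym // => e; apply: PNQR; rewrite e pt_oppK.
  - by rewrite eq_sym.
have ml : m - l != 0.
  by apply: contraNN x13 => /eqP e; rewrite eq_sym -subr_eq0 -en e mulr0.
have enk : n = k + m - l.
  apply: (addIr l); apply: (mulIf ml); rewrite en subrK -[RHS]opprK -mulrN opprB ek.
  by rewrite opprB.
rewrite enk subrK in en.
case: hl hm => [l1 _] [m1 _].
have x3E : R.1 = P.1 + (k + m) * (m - l) by rewrite en; ring.
have y1E : P.2 = Q.2 - l * (Q.1 - P.1) by rewrite -l1; ring.
have y3E : R.2 = Q.2 + m * (R.1 - Q.1) by rewrite -m1; ring.
rewrite -(third_sym hn) enk /third /=; congr (Some _).
have ex : (k + m - l) ^+ 2 - a - R.1 - (l ^+ 2 - a - P.1 - Q.1) =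
  k ^+ 2 - a - P.1 - (m ^+ 2 - a - Q.1 - R.1) by rewrite x3E; ring.
congr (_, _); first exact: ex.
by rewrite ex y3E y1E x3E; ring.
Qed.

(** * Multiples and iterated doubling of a point *)

Lemma ec_mul_on_curve n P : ec_point f P -> ec_point f (ec_mul f n P).
Proof. by move=> hP; elim: n => //= n IHn; apply: ec_add_on_curve. Qed.

Lemma ec_mulS n P : ec_mul f n.+1 P = ec_add f P (ec_mul f n P).
Proof. by []. Qed.

Lemma ec_mul_double n P : ec_point f P ->
  ec_mul f n.*2 P = ec_add f (ec_mul f n P) (ec_mul f n P).
Proof.
move=> hP; elim: n => // n IHn; have hn := ec_mul_on_curve n hP.
rewrite doubleS !ec_mulS IHn.
rewrite ec_addA //; last exact: ec_add_on_curve.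
congr (ec_add f P _); rewrite (ec_addC hP hn) -(ec_addA hn hn hP).
exact: ec_addC (ec_add_on_curve hn hn).
Qed.

Let double P := ec_add f P P.

Lemma ec_mul_exp2 i P : ec_point f P -> ec_mul f (2 ^ i) P = iter i double P.
Proof.
move=> hP; elim: i => [|i IHi] /=; first exact: ec_add0.
by rewrite expnS mul2n ec_mul_double // IHi.
Qed.

(* Write n = 2^e m with m odd and take k = totient m: 2^(e+k) = 2^e mod n. *)
Lemma torsion_preperiodic P : ec_torsion f P ->
  exists i k, (0 < k)%N /\ iter (k + i) double P = iter i double P.
Proof.
case=> hP [n n0 nP].
have mulMD q r : ec_mul f (q * n + r) P = ec_mul f r P.
  rewrite addnC /ec_mul iterD; congr (iter _ _ _).
  by elim: q => //= q IHq; rewrite mulSn iterD IHq.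
have [e [m [om nE]]] : exists e m, odd m /\ n = (2 ^ e * m)%N.
  have [m cm nE] := pfactor_coprime (isT : prime 2) n0.
  by exists (logn 2 n), m; rewrite -coprime2n mulnC.
exists e, (totient m); split.
  by rewrite totient_gt0; case: m om {nE}.
rewrite -!ec_mul_exp2 // addnC.
have : (2 ^ (e + totient m) = 2 ^ e %[mod n])%N.
  have Euler : (2 ^ totient m = 1 %[mod m])%N.
    by apply: cyclic.Euler_exp_totient; rewrite coprime2n.
  by rewrite expnD nE -muln_modr Euler muln_modr muln1.
by move=> en; rewrite (divn_eq (2 ^ (e + totient m))%N n) mulMD en -[in LHS](mulMD (2 ^ e %/ n)%N) -divn_eq.
Qed.
End GroupLaw.

(** * Torsion of y^2 = x (x - A^2) (x + B^2) *)

Section TorsionSubgroup.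
Variables A B C : rat.
Hypotheses (A0 : A != 0) (B0 : B != 0) (C0 : C != 0).
Hypothesis ABC : A ^+ 2 + B ^+ 2 = C ^+ 2.

Let f : {poly rat} := 'X * ('X - (A ^+ 2)%:P) * ('X + (B ^+ 2)%:P).

Lemma frey_monic : f \is monic.
Proof.
rewrite /f -[B ^+ 2]opprK polyCN.
by rewrite !monicMl ?monicX ?monicXsubC.
Qed.

Lemma frey_size : size f = 4%N.
Proof.
rewrite /f -[B ^+ 2]opprK polyCN.
rewrite size_Mmonic ?monicXsubC ?mulf_neq0 ?polyX_eq0 ?polyXsubC_eq0 //.
rewrite size_Mmonic ?monicXsubC ?polyX_eq0 //.
by rewrite size_polyX !size_XsubC.
Qed.

Lemma frey_horner x : f.[x] = x * (x - A ^+ 2) * (x + B ^+ 2).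
Proof. by rewrite /f !hornerE. Qed.

Lemma frey_deriv x : f^`().[x] = 3 * x ^+ 2 + 2 * (B ^+ 2 - A ^+ 2) * x - A ^+ 2 * B ^+ 2.
Proof. have -> : f^`().[x] = (x - A ^+ 2 + x) * (x + B ^+ 2) + x * (x - A ^+ 2).
  by rewrite /f !derivE !hornerE.
ring. Qed.

Lemma frey_coef2 : f`_2 = B ^+ 2 - A ^+ 2.
Proof.
rewrite /f; move: (A ^+ 2) (B ^+ 2) => a b.
have -> : 'X * ('X - a%:P) * ('X + b%:P) =
    'X^3 + (b - a)%:P * 'X^2 - (a * b)%:P * 'X :> {poly rat}.
  by rewrite polyCB polyCM; move: a%:P b%:P => p q; ring.
by rewrite !coefE /=; ring.
Qed.

Lemma frey_sep x : f.[x] = 0 -> f^`().[x] != 0.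
Proof.
rewrite frey_horner frey_deriv => /eqP; rewrite !mulf_eq0 => /orP[/orP[]|] /eqP h.
- have -> : x = 0 by [].
  rewrite (_ : _ - _ = - (A * B) ^+ 2); last by ring.
  by rewrite oppr_eq0 expf_neq0 ?mulf_neq0.
- have -> : x = A ^+ 2 by apply/eqP; rewrite -subr_eq0 h.
  rewrite (_ : _ - _ = A ^+ 2 * (A ^+ 2 + B ^+ 2)); last by ring.
  by rewrite ABC -exprMn expf_neq0 ?mulf_neq0.
- have -> : x = - B ^+ 2 by apply/eqP; rewrite -subr_eq0 opprK h.
  rewrite (_ : _ - _ = B ^+ 2 * (A ^+ 2 + B ^+ 2)); last by ring.
  by rewrite ABC -exprMn expf_neq0 ?mulf_neq0.
Qed.

Let double P := ec_add f P P.

Lemma double_two_torsion x : double (Some (x, 0)) = None.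
Proof. by rewrite /double /= oppr0 !eqxx. Qed.

(** Square roots from the duplication formula: if [P] has nonzero ordinate and [x] is the abscissa
    of its double, [u P], [v P], [w P] square to [x], [x - A^2], [x + B^2]. *)
Let u (P : rat * rat) := (P.1 ^+ 2 + A ^+ 2 * B ^+ 2) / (2 * P.2).
Let v (P : rat * rat) := (P.1 ^+ 2 - 2 * A ^+ 2 * P.1 - A ^+ 2 * B ^+ 2) / (2 * P.2).
Let w (P : rat * rat) := (P.1 ^+ 2 + 2 * B ^+ 2 * P.1 - A ^+ 2 * B ^+ 2) / (2 * P.2).

Lemma doubleP (P : rat * rat) : ec_point f (Some P) -> P.2 != 0 ->
  exists Q : rat * rat, [/\ double (Some P) = Some Q,
    Q.1 = u P ^+ 2, Q.1 - A ^+ 2 = v P ^+ 2 & Q.1 + B ^+ 2 = w P ^+ 2].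
Proof.
case: P => x y hP; rewrite /= in hP * => y0.
rewrite frey_horner in hP.
have y2 : (y == - y) = false.
  by apply/negbTE; rewrite -addr_eq0 -mulr2n mulrn_eq0.
rewrite /double /= eqxx y2 /= frey_coef2 frey_deriv /u /v /w /=.
move: hP; rewrite -{2}/(A ^+ 2) -/(B ^+ 2); move: (A ^+ 2) (B ^+ 2) => a b hP.
have den z r : y ^+ 2 * ((z / (2 * y)) ^+ 2 - r) = (z / 2) ^+ 2 - y ^+ 2 * r by field.
have y20 : y ^+ 2 != 0 by rewrite expf_neq0.
set l := _ / (2 * y).
have e : l ^+ 2 - (b - a) - x - x = ((x ^+ 2 + a * b) / (2 * y)) ^+ 2.
  have: forall r, y ^+ 2 * (l ^+ 2 - r) = _ := den _.
  move: l => l dl; rewrite -[RHS]subr0; apply: (mulfI y20); rewrite den.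
  rewrite (_ : _ - x - x = l ^+ 2 - (b - a + x + x)); last by ring.
  by rewrite dl hP; field.
eexists; split; first by []; rewrite /= e //.
  by rewrite -[RHS]subr0; apply: (mulfI y20); rewrite !den hP; field.
rewrite -[b in LHS]opprK.
by rewrite -[RHS]subr0; apply: (mulfI y20); rewrite !den hP; field.
Qed.

Lemma frey_eq (P : rat * rat) : ec_point f (Some P) ->
  P.2 ^+ 2 = P.1 * (P.1 - A ^+ 2) * (P.1 + B ^+ 2).
Proof. by case: P => x y /= ->; rewrite frey_horner. Qed.

Lemma double_on_curve P : ec_point f P -> ec_point f (double P).
Proof.
by move=> hP; apply: (ec_add_on_curve frey_monic frey_size).
Qed.

(** The affine points of the subgroup Z/2 x Z/4: those of order 2, and those with double [(A^2, 0)].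
    As [A^2 + B^2 = C^2], the second condition says that the numerator of [v P] vanishes. *)
Let small (P : rat * rat) := P.2 = 0 \/ (P.1 - A ^+ 2) ^+ 2 = (A * C) ^+ 2.

(** If [Q] has order 4, then [(v P)^4 = (A C)^2], against Fermat's theorem since [C^2 - A^2 = B^2].
    If [Q] has order 2, its abscissa is a nonzero square, so it must be [A^2], and [v P = 0]. *)
Lemma double_small (P Q : rat * rat) : ec_point f (Some P) ->
  double (Some P) = Some Q -> small Q -> small P.
Proof.
move=> hP; have [y0|y0] := eqVneq P.2 0; first by left.
move=> dP; have := double_on_curve hP.
have [R [dR uE vE wE]] := doubleP hP y0; move: dR; rewrite dP => -[eR] /frey_eq.
rewrite {}eR => RE; have x0 : R.1 != 0.
  rewrite uE expf_neq0 // mulf_neq0 ?invr_eq0 ?mulf_neq0 //.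
  by rewrite -exprMn gt_eqF // ltr_wpDl ?sqr_ge0 // lt_neqAle sqr_ge0 eq_sym expf_neq0 // mulf_neq0.
have xB0 : R.1 + B ^+ 2 != 0.
  by rewrite gt_eqF // uE ltr_wpDl ?sqr_ge0 // lt_neqAle sqr_ge0 eq_sym expf_neq0.
case=> [R0|sR]; last first.
  exfalso; apply: (@fermat_pair C A B (v P)) => //.
    by rewrite -ABC; ring.
  by rewrite mulrC -sR vE -exprM.
right; have : v P ^+ 2 = 0.
  have /eqP := RE; rewrite R0 expr0n eq_sym !mulf_eq0 (negPf x0) (negPf xB0) orbF /= -vE.
  by move/eqP.
move/eqP; rewrite expf_eq0 /= !mulf_eq0 !invr_eq0 mulf_eq0 (negPf y0) !orbF.
move=> /eqP h; rewrite exprMn -ABC -[RHS]addr0 -h; ring.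
Qed.

Lemma torsion_orbit_small i (P : rat * rat) : ec_point f (Some P) ->
  iter i double (Some P) = None -> small P.
Proof.
elim: i P => // i IHi P hP; rewrite iterSr.
have [y0|y0] := eqVneq P.2 0; first by left.
have [R [dR _ _ _]] := doubleP hP y0; rewrite dR => hR.
apply: (double_small hP dR); apply: IHi => //.
by rewrite -dR; exact: double_on_curve.
Qed.

Lemma no_affine_cycle (k : nat) (P : rat * rat) : (0 < k)%N ->
  ec_point f (Some P) -> iter k double (Some P) <> Some P.
Proof.
move=> k0 hP per.
pose R i := iter i double (Some P).
have RS i : R i.+1 = double (R i) by [].
have Rper i : R (i + k)%N = R i by rewrite /R iterD per.
have curveR i : ec_point f (R i) by elim: i => //= i; exact: double_on_curve.
have perM n : R (n * k)%N = Some P by elim: n => //= n IHn; rewrite mulSnr Rper.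
(* [None] is fixed by doubling, so an orbit reaching it could not return to [P]. *)
have affR i : R i != None.
  apply/eqP => Ri; have := perM i; rewrite -(subnK (leq_pmulr i k0)) /R iterD -/(R i) Ri.
  by have -> : iter (i * k - i) double None = None by elim: (_ - _)%N => //= n ->.
have [Q QE] : exists Q : nat -> rat * rat, forall i, R i = Some (Q i).
  exists (fun i => odflt P (R i)) => i.
  by case: (R i) (affR i).
have Q0 i : (Q i).2 != 0.
  apply/eqP => y0; have := affR i.+1; rewrite RS QE.
  by rewrite (surjective_pairing (Q i)) y0 double_two_torsion.
have QS i : [/\ (Q i.+1).1 = u (Q i) ^+ 2, (Q i.+1).1 - A ^+ 2 = v (Q i) ^+ 2,
    (Q i.+1).1 + B ^+ 2 = w (Q i) ^+ 2 &
    (Q i.+1).2 ^+ 2 = (u (Q i) * v (Q i) * w (Q i)) ^+ 2].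
  have hQ : ec_point f (Some (Q i)) by rewrite -QE; exact: curveR.
  have [S [dS uE vE wE]] := doubleP hQ (Q0 i).
  have -> : Q i.+1 = S by have := RS i; rewrite !QE dS => -[].
  split=> //; rewrite 2!exprMn -uE -vE -wE; apply: frey_eq.
  by rewrite -dS; exact: double_on_curve.
have nz i : [/\ u (Q i) != 0, v (Q i) != 0 & w (Q i) != 0].
  have [_ _ _ e] := QS i.
  have : (u (Q i) * v (Q i) * w (Q i)) ^+ 2 != 0 by rewrite -e expf_neq0.
  by rewrite expf_eq0 /= !mulf_eq0 !negb_or => /andP[/andP[]].
have Qper i : Q (i + k)%N = Q i by have := Rper i; rewrite !QE => -[].
apply: (@no_doubling_cycle A B C (u \o Q) (v \o Q) (w \o Q) k) => // i /=.
- by rewrite Qper.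
- by have [-> vE wE _] := QS i; rewrite -vE -wE; split; ring.
have [uE vE wE yE] := QS i; have [u0 v0 w0] := nz i; have y0 := Q0 i.+1.
(* At [Q i.+1 = (x, y)] one has [u + v = x (x - A^2) / y], where [x], [x - A^2] and, up to sign, [y]
   are [u^2], [v^2] and [u v w] taken at [Q i]. The other two sums are similar. *)
have aux r s q y : r != 0 -> s != 0 -> q != 0 -> y ^+ 2 = (r * s * q) ^+ 2 ->
    ((r * s) ^+ 2 / y * q) ^+ 2 = (r * s) ^+ 2 :> rat.
  by move=> r0 s0 q0 ey; rewrite exprMn expr_div_n ey; field; rewrite ?r0 ?s0 ?q0.
split.
- have -> : u (Q i.+1) + v (Q i.+1) = (u (Q i) * v (Q i)) ^+ 2 / (Q i.+1).2.
    by rewrite exprMn -uE -vE /u /v; field.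
  exact: aux.
- have -> : u (Q i.+1) + w (Q i.+1) = (u (Q i) * w (Q i)) ^+ 2 / (Q i.+1).2.
    by rewrite exprMn -uE -wE /u /w; field.
  by apply: aux => //; rewrite yE mulrAC.
- have -> : v (Q i.+1) + w (Q i.+1) = (v (Q i) * w (Q i)) ^+ 2 / (Q i.+1).2.
    by rewrite exprMn -vE -wE /v /w; field.
  by apply: aux => //; rewrite yE -mulrA mulrC.
Qed.

Theorem ec_torsionE x y : ec_point f (Some (x, y)) ->
  ec_torsion f (Some (x, y)) <-> y = 0 \/ (x - A ^+ 2) ^+ 2 = (A * C) ^+ 2.
Proof.
move=> hP; split=> [tors|sm].
  have [i [k [k0 per]]] := torsion_preperiodic frey_monic frey_size frey_sep isT tors.
  case E : (iter i double (Some (x, y))) => [Q|].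
    case: (no_affine_cycle k0 (P := Q)); first last.
      by rewrite -E -iterD.
    by rewrite -E; elim: i {per E} => //= i; exact: double_on_curve.
  exact: torsion_orbit_small E.
have mul2 : ec_mul f 2 (Some (x, y)) = double (Some (x, y)) by [].
split=> //; have [y0|y0] := eqVneq y 0.
  by exists 2%N; rewrite ?mul2 // y0 double_two_torsion.
case: sm => [/eqP|sx]; first by rewrite (negPf y0).
have [Q [dP _ vE _]] := doubleP hP y0.
have v0 : v (x, y) = 0.
  rewrite /v /= (_ : x ^+ 2 - _ - _ = (x - A ^+ 2) ^+ 2 - A ^+ 2 * (A ^+ 2 + B ^+ 2)).
    by rewrite sx ABC exprMn subrr mul0r.
  by ring.
have Q0 : Q.2 = 0.
  have hQ : ec_point f (Some Q) by rewrite -dP; exact: double_on_curve.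
  by apply/eqP; rewrite -sqrf_eq0 frey_eq // vE v0 expr0n mulr0 mul0r.
exists 4%N => //; transitivity (double (double (Some (x, y)))).
  exact: (ec_mul_exp2 frey_monic frey_size frey_sep isT 2 hP).
by rewrite dP (surjective_pairing Q) Q0 double_two_torsion.
Qed.

End TorsionSubgroup.

(** * Cuboids *)

Lemma sqr_sub1_neq0 (s : rat) : s != 1 -> s != -1 -> s ^+ 2 - 1 != 0.
Proof. by move=> s1 sN1; rewrite subr_eq0 sqrf_eq1 negb_or s1. Qed.

Lemma sqr_add1_neq0 (s : rat) : s ^+ 2 + 1 != 0.
Proof. by rewrite gt_eqF // ltr_wpDl ?sqr_ge0. Qed.

(** The criterion of [ec_torsionE] for [A = 2 s], [B = s^2 - 1], [C = s^2 + 1]. *)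
Definition E1_nontorsion (s alpha beta : rat) : Prop :=
  [/\ beta ^+ 2 =
        alpha * (alpha - (2 * s) ^+ 2) * (alpha + (s ^+ 2 - 1) ^+ 2),
      beta != 0 & (alpha - (2 * s) ^+ 2) ^+ 2 != (2 * s * (s ^+ 2 + 1)) ^+ 2].

Lemma tildeAE (s alpha beta : rat) : tildeA (s, alpha, beta) <->
  [/\ s != 0, s != 1, s != -1 & E1_nontorsion s alpha beta].
Proof.
have E s0 s1 sN1 := @ec_torsionE (2 * s) (s ^+ 2 - 1) (s ^+ 2 + 1)
  (mulf_neq0 (isT : 2 != 0 :> rat) s0) (sqr_sub1_neq0 s1 sN1) (sqr_add1_neq0 s).
have pyth : (2 * s) ^+ 2 + (s ^+ 2 - 1) ^+ 2 = (s ^+ 2 + 1) ^+ 2 by ring.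
split=> -[s0 s1 sN1].
  move=> [hP nt]; split=> //; split; first by rewrite /= frey_horner in hP.
    by apply: contra_notN nt => /eqP b0; apply/E => //; left.
  by apply: contra_notN nt => /eqP b0; apply/E => //; right.
move=> [hb b0 ha]; have hP : ec_point (E1 s) (Some (alpha, beta)).
  by rewrite /= frey_horner.
split=> //; split=> // /E -[] // /eqP; first by rewrite (negPf b0).
by rewrite (negPf ha).
Qed.

(** Supplies the edge [FG] as [|g|]. It is nonzero because [beta] is, and then [t = 0] is impossible
    since [gamma_of] would vanish. *)
Lemma edge_param (s alpha beta : rat) : s != 0 -> s != 1 -> s != -1 ->
  E1_nontorsion s alpha beta ->
  let t := t_of s alpha in exists g : rat,
    [/\ t != 0, t ^+ 2 != 1, g != 0 & (t ^+ 2 - 1) ^+ 2 + g ^+ 2 = gamma_of s alpha].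
Proof.
move=> s0 s1 sN1 [hb b0 ha] t.
have B0 := sqr_sub1_neq0 s1 sN1; have C0 := sqr_add1_neq0 s.
set D := alpha + 2 * s ^+ 2 * (s ^+ 2 - 1).
(* A zero denominator would make [beta^2] the negative of a square. *)
have D0 : D != 0.
  apply/eqP => D0; have aE : alpha = - (2 * s ^+ 2 * (s ^+ 2 - 1)).
    by apply/eqP; rewrite -addr_eq0 -D0.
  have : beta ^+ 2 + (2 * s ^+ 2 * (s ^+ 2 - 1) * (s ^+ 2 + 1)) ^+ 2 = 0.
    by rewrite hb aE; ring.
  move/eqP; rewrite paddr_eq0 ?sqr_ge0 // sqrf_eq0 (negPf b0) //.
have tD : t * D = s * alpha - 2 * s * (s ^+ 2 - 1) by rewrite /t /t_of divfK.
have gE : (t ^+ 2 - 1) ^+ 2 + (2 * (s ^+ 4 - 1) * beta / D ^+ 2) ^+ 2 = gamma_of s alpha.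
  rewrite [2 * _ * beta / _]mulrAC [(_ * beta) ^+ 2]exprMn hb /gamma_of -/t.
  have -> : t = (s * alpha - 2 * s * (s ^+ 2 - 1)) / D by rewrite -tD mulfK.
  have -> : D = alpha + 2 * s ^+ 2 * (s ^+ 2 - 1) by [].
  by field; rewrite s0 -/D D0.
have g0 : 2 * (s ^+ 4 - 1) * beta / D ^+ 2 != 0.
  rewrite !mulf_neq0 ?invr_eq0 ?expf_neq0 //.
  by rewrite (_ : _ - 1 = (s ^+ 2 - 1) * (s ^+ 2 + 1)) ?mulf_neq0 //; ring.
exists (2 * (s ^+ 4 - 1) * beta / D ^+ 2); split=> //.
  apply: contra_neq g0 => t0; move/eqP: gE.
  rewrite /gamma_of -/t t0 expr0n /= mul0r paddr_eq0 ?sqr_ge0 // sqrf_eq0.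
(* [(t D)^2 - D^2] is [s^2 - 1] times the difference of the two sides of [ha], so [t^2 = 1] would
   mean a point of order 4. *)
apply: contra_neq ha => t1; apply/eqP; rewrite -subr_eq0; apply/eqP.
apply: (mulfI B0); rewrite mulr0.
have : (t * D) ^+ 2 - D ^+ 2 = 0 by rewrite exprMn t1 mul1r subrr.
by rewrite tD /D => <-; ring.
Qed.

Lemma edge_param_inv (x y z d e h : rat) :
  0 < x -> 0 < y -> 0 < z -> 0 < d -> 0 < e -> 0 < h ->
  x ^+ 2 + y ^+ 2 = d ^+ 2 -> y ^+ 2 + z ^+ 2 = e ^+ 2 -> x ^+ 2 + e ^+ 2 = h ^+ 2 ->
  exists s alpha beta l : rat,
    [/\ 0 < l, tildeA (s, alpha, beta), 2 * `|t_of s alpha| = l * x,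
        `|t_of s alpha ^+ 2 - 1| = l * y & gamma_of s alpha = (l * e) ^+ 2].
Proof.
move=> x0 y0 z0 d0 e0 h0 xyd yze xeh.
have yd : y < d by rewrite -ltr_sqr ?nnegrE ?ltW // -xyd ltrDr exprn_gt0.
have dy0 : 0 < d - y by rewrite subr_gt0.
have eh : e < h by rewrite -ltr_sqr ?nnegrE ?ltW // -xeh ltrDr exprn_gt0.
have xh : x < h by rewrite -ltr_sqr ?nnegrE ?ltW // -xeh ltrDl exprn_gt0.
have x0' := gt_eqF x0; have dy0' := gt_eqF dy0.
(* [l] scales the cuboid so that [2 t = l x] and [t^2 - 1 = l y], using [x^2 = (d - y) (d + y)].
   Since [x^2 = (h + e) (h - e)], [1 / s = (h - e) / x] and [s - 1 / s = 2 e / x]. *)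
pose s := (e + h) / x; pose t := x / (d - y); pose l := 2 / (d - y).
have s1 : 1 < s by rewrite ltr_pdivlMr // mul1r (lt_trans xh) // ltrDr.
have s0 : s != 0 by rewrite gt_eqF // (lt_trans _ s1).
have sN1 : s != -1 by rewrite gt_eqF // (lt_trans _ s1).
have s1' : s != 1 by rewrite gt_eqF.
have B0 := sqr_sub1_neq0 s1' sN1; have C0 := sqr_add1_neq0 s.
have l0 : 0 < l by rewrite divr_gt0.
have t0 : 0 < t by rewrite divr_gt0.
have tx : 2 * t = l * x by rewrite /t /l; field; rewrite dy0'.
have ty : t ^+ 2 - 1 = l * y.
  have : x ^+ 2 = d ^+ 2 - y ^+ 2 by rewrite -xyd addrK.
  by move=> xE; rewrite /t /l expr_div_n xE; field; rewrite dy0'.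
have sh : s - 1 / s = 2 * e / x.
  have sE : 1 / s = (h - e) / x.
    apply: (mulfI s0); rewrite mulrCA mul1r divff // /s mulrACA -invfM.
    rewrite (_ : (e + h) * (h - e) = x * x) ?divff ?mulf_neq0 ?x0' //.
    by rewrite -expr2 -(addrK (e ^+ 2) (x ^+ 2)) xeh; ring.
  by rewrite sE /s; field; rewrite x0'.
have te : t * (s - 1 / s) = l * e.
  by rewrite sh /t /l; field; rewrite x0' dy0'.
pose g := l * z.
have gE : g ^+ 2 = t ^+ 2 * (s - 1 / s) ^+ 2 - (t ^+ 2 - 1) ^+ 2.
  by rewrite -exprMn te ty /g !exprMn -yze; ring.
have g0 : g != 0 by rewrite mulf_neq0 ?gt_eqF.
clearbody g s t l.
have t21 : t ^+ 2 - 1 != 0 by rewrite ty mulf_neq0 ?gt_eqF.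
have st0 : s - t != 0.
  apply: contra_neq g0 => /eqP; rewrite subr_eq0 => /eqP st; apply/eqP.
  by rewrite -sqrf_eq0 gE -st; apply/eqP; field.
(* [alpha] solves [t_of s alpha = t], a Moebius equation, and [D] is the denominator of [t_of]
   there; [beta] below inverts the formula for [g] in [edge_param]. *)
pose alpha := 2 * s * (s ^+ 2 - 1) * (1 + s * t) / (s - t).
pose D := 2 * s * (s ^+ 2 - 1) * (s ^+ 2 + 1) / (s - t).
have DE : alpha + 2 * s ^+ 2 * (s ^+ 2 - 1) = D by rewrite /alpha /D; field.
have D0 : D != 0 by rewrite /D !mulf_neq0 ?invr_eq0.
have t_ofE : t_of s alpha = t.
  rewrite /t_of DE; apply: (mulIf D0); rewrite divfK //.
  by rewrite /alpha /D; field.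
have s40 : s ^+ 4 - 1 != 0.
  by rewrite (_ : _ - 1 = (s ^+ 2 - 1) * (s ^+ 2 + 1)) ?mulf_neq0 //; ring.
exists s, alpha, (g * D ^+ 2 / (2 * (s ^+ 4 - 1))), l; split=> //.
- apply/tildeAE; split=> //; split.
  + rewrite mulrAC -mulrA exprMn [g ^+ 2]gE /alpha /D.
    by field; rewrite s0 st0 s40.
  + by rewrite !mulf_neq0 ?invr_eq0 ?expf_neq0 ?mulf_neq0.
  + have -> : alpha - (2 * s) ^+ 2 = 2 * s * (s ^+ 2 + 1) * ((s * t - 1) / (s - t)).
      by rewrite /alpha; field.
    rewrite exprMn -subr_eq0 -[X in _ - X]mulr1 -mulrBr mulf_neq0 ?expf_neq0 ?mulf_neq0 //.
    rewrite (_ : _ - 1 = (s ^+ 2 - 1) * (t ^+ 2 - 1) / (s - t) ^+ 2).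
      by rewrite !mulf_neq0 ?invr_eq0 ?expf_neq0.
    by field.
- by rewrite t_ofE gtr0_norm.
- by rewrite t_ofE ty gtr0_norm // mulr_gt0.
- by rewrite /gamma_of t_ofE -exprMn te.
Qed.

(** * Lengths and equivalence classes of Euclidean cuboids *)

Section Cuboids.
Variable R : realType.
Implicit Types (K : cuboid R) (u v w : 'rV[R]_3).

Lemma dotpC u v : dotp u v = dotp v u.
Proof. by apply: eq_bigr => i _; rewrite mulrC. Qed.

Lemma dotpDl u v w : dotp (u + v) w = dotp u w + dotp v w.
Proof. by rewrite /dotp -big_split; apply: eq_bigr => i _; rewrite mxE mulrDl. Qed.

Lemma dotpNl u v : dotp (- u) v = - dotp u v.
Proof. by rewrite /dotp -sumrN; apply: eq_bigr => i _; rewrite mxE mulNr. Qed.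

Lemma dotpDr u v w : dotp w (u + v) = dotp w u + dotp w v.
Proof. by rewrite dotpC dotpDl !(dotpC w). Qed.

Lemma dotpNr u v : dotp u (- v) = - dotp u v.
Proof. by rewrite dotpC dotpNl dotpC. Qed.

Lemma dotp_ge0 u : 0 <= dotp u u.
Proof. by apply: sumr_ge0 => i _; rewrite -expr2 sqr_ge0. Qed.

Lemma dotp_eq0 u : dotp u u = 0 -> u = 0.
Proof.
move=> u0; apply/rowP => i; rewrite mxE; apply/eqP; rewrite -sqrf_eq0.
move/eqP: u0; rewrite psumr_eq0 => [|j _]; last by rewrite -expr2 sqr_ge0.
by move=> /allP /(_ i); rewrite mem_index_enum expr2 => /(_ isT).
Qed.

Lemma dist_sqr u v : dist u v ^+ 2 = dotp (u - v) (u - v).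
Proof. by rewrite sqr_sqrtr ?dotp_ge0. Qed.

Lemma dist_gt0 u v : u != v -> 0 < dist u v.
Proof.
move=> uv; rewrite sqrtr_gt0 lt_neqAle dotp_ge0 andbT eq_sym.
by apply: contra_neq uv => /dotp_eq0 /eqP; rewrite subr_eq0 => /eqP.
Qed.

Lemma dist_sym u v : dist u v = dist v u.
Proof. by rewrite /dist -(opprB v) dotpNl dotpNr opprK. Qed.

Lemma BF_gt0 K : 0 < BF K. Proof. exact/dist_gt0/vB_neqF. Qed.
Lemma EF_gt0 K : 0 < EF K. Proof. exact/dist_gt0/vE_neqF. Qed.
Lemma FG_gt0 K : 0 < FG K.
Proof. by rewrite /FG dist_sym; exact/dist_gt0/vG_neqF. Qed.

Lemma dotp_orth u v : dotp u v = 0 -> dotp (u + v) (u + v) = dotp u u + dotp v v.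
Proof. by move=> uv; rewrite dotpDl !dotpDr (dotpC v u) uv addr0 add0r. Qed.

Lemma BE_sqr K : BE K ^+ 2 = BF K ^+ 2 + EF K ^+ 2.
Proof.
rewrite !dist_sqr; have -> : vB K - vE K = (vB K - vF K) - (vE K - vF K).
  by rewrite opprB addrA subrK.
rewrite (@dotp_orth _ (- (vE K - vF K))); last by rewrite dotpNr FB_orth_FE oppr0.
by rewrite [dotp (- _) _]dotpNl dotpNr opprK.
Qed.

Lemma HF_sqr K : HF K ^+ 2 = EF K ^+ 2 + FG K ^+ 2.
Proof.
rewrite /FG dist_sym !dist_sqr /vH addrAC.
by rewrite (dotp_orth (FE_orth_FG K)).
Qed.

Lemma DF_sqr K : DF K ^+ 2 = BF K ^+ 2 + HF K ^+ 2.
Proof.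
rewrite !dist_sqr /vD /vH addrAC.
have -> : vB K + (vE K - vF K) - vF K + (vG K - vF K) =
    (vB K - vF K) + (vE K + (vG K - vF K) - vF K).
  by rewrite [vB K + _ - _]addrAC [vE K + _ - _]addrAC !addrA.
rewrite (@dotp_orth (vB K - vF K)) // [vE K + _ - _]addrAC dotpDr.
by rewrite FB_orth_FE FB_orth_FG addr0.
Qed.

Lemma BE_ge0 K : 0 <= BE K. Proof. exact: sqrtr_ge0. Qed.
Lemma HF_ge0 K : 0 <= HF K. Proof. exact: sqrtr_ge0. Qed.
Lemma DF_ge0 K : 0 <= DF K. Proof. exact: sqrtr_ge0. Qed.

Lemma cuboid_exists (x y z : R) : 0 < x -> 0 < y -> 0 < z ->
  exists K, [/\ BF K = x, EF K = y & FG K = z].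
Proof.
move=> x0 y0 z0; pose e i : 'rV[R]_3 := delta_mx 0 i.
have ee i j (a b : R) : dotp (a *: e i) (b *: e j) = a * b * (i == j)%:R.
  rewrite /dotp (bigD1 i) //= big1 ?addr0 => [|k /negPf ki]; rewrite !mxE ?eqxx /=.
    by rewrite mulr1 mulrA.
  by rewrite ki mulr0 mul0r.
have nz i (a : R) : 0 < a -> a *: e i != 0.
  move=> a0; apply/eqP => /(congr1 (fun u => dotp u u)); rewrite ee eqxx mulr1.
  rewrite (_ : dotp 0 0 = 0); last by rewrite /dotp big1 // => j _; rewrite mxE mul0r.
  by apply/eqP; rewrite mulf_neq0 ?gt_eqF.
have len i (a : R) : 0 < a -> dist (a *: e i) 0 = a.
  by move=> a0; rewrite /dist subr0 ee eqxx mulr1 -expr2 sqrtr_sqr gtr0_norm.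
have orth i j (a b : R) : i != j -> dotp (a *: e i - 0) (b *: e j - 0) = 0.
  by move=> /negPf ij; rewrite !subr0 ee ij mulr0.
exists (@Cuboid R 0 (x *: e 0) (y *: e 1) (z *: e 2%:R) (nz _ _ x0) (nz _ _ y0)
  (nz _ _ z0) (orth 0 1 x y isT) (orth 0 2%:R x z isT) (orth 1 2%:R y z isT)).
by split; [exact: len|exact: len|rewrite /FG dist_sym; exact: len].
Qed.

Lemma ratr_eq_of_sqr (x : R) (q : rat) : 0 <= x -> x ^+ 2 = ratr (q ^+ 2) ->
  x = ratr `|q|.
Proof.
move=> x0 e; apply/eqP; rewrite -(@eqrXn2 _ 2) ?ler0q //.
by rewrite e -rmorphXn /= real_normK ?num_real.
Qed.

Lemma cuboid_equiv_of (K K' : cuboid R) (l : rat) : 0 < l ->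
  BF K = ratr l * BF K' -> EF K = ratr l * EF K' -> HF K = ratr l * HF K' ->
  cuboid_equiv K K'.
Proof.
move=> l0 eB eE eH; exists l; split=> //; apply/eqP.
have h (J : cuboid R) : FG J ^+ 2 = HF J ^+ 2 - EF J ^+ 2.
  by rewrite HF_sqr addrAC subrr add0r.
have lF0 : 0 <= ratr l * FG K'.
  by apply: mulr_ge0 (ltW (FG_gt0 K')); rewrite ler0q ltW.
rewrite -(@eqrXn2 _ 2) //; last exact: ltW (FG_gt0 K).
by rewrite h eH eE !(exprMn _ (ratr l)) -mulrBr -h.
Qed.

Lemma cuboid_class_eq (K K' : cuboid R) : cuboid_equiv K K' ->
  cuboid_class K = cuboid_class K'.
Proof.
move=> [l [eB eE eF]].
have l0 : ratr l != 0 :> R.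
  by apply/eqP => l0; have := BF_gt0 K; rewrite eB l0 mul0r ltxx.
apply/seteqP; split=> J [rJ [m [mB mE mF]]]; split=> //.
  have div (a b c : R) : a = ratr l * b -> a = ratr m * c -> b = ratr (m / l) * c.
    by move=> e1 e2; rewrite fmorph_div /= mulrAC -e2 e1 mulrC mulKf.
  by exists (m / l); split; [exact: div eB mB|exact: div eE mE|exact: div eF mF].
by exists (l * m); rewrite rmorphM eB eE eF mB mE mF /= !mulrA.
Qed.

Lemma rational_face_cuboid_of_sqr (K : cuboid R) (x y z d e h : rat) :
  BF K = ratr x -> EF K = ratr y -> FG K = ratr z ->
  x ^+ 2 + y ^+ 2 = d ^+ 2 -> y ^+ 2 + z ^+ 2 = e ^+ 2 -> x ^+ 2 + e ^+ 2 = h ^+ 2 ->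
  rational_face_cuboid K.
Proof.
move=> eB eE eF hd he hh.
have HFE : HF K = ratr `|e|.
  by apply: ratr_eq_of_sqr (HF_ge0 K) _; rewrite HF_sqr eE eF -he rmorphD !rmorphXn.
split; first by split; eexists; eassumption.
split; [exists (`|d|)|exists (`|e|)|exists (`|h|)] => //.
  by apply: ratr_eq_of_sqr (BE_ge0 K) _; rewrite BE_sqr eB eE -hd rmorphD !rmorphXn.
apply: ratr_eq_of_sqr (DF_ge0 K) _; rewrite DF_sqr eB HFE -hh rmorphD !rmorphXn /=.
by rewrite -[X in _ + X]rmorphXn /= real_normK ?num_real // rmorphXn.
Qed.

Lemma attached_cuboid_exists (s alpha beta : rat) : tildeA (s, alpha, beta) ->
  exists K, attached_cuboid s alpha K.
Proof.
move=> /tildeAE[s0 s1 sN1 nt].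
have [g [t0 t1 g0 gE]] := edge_param s0 s1 sN1 nt.
move: t0 t1 gE; rewrite /attached_cuboid /= /gamma_of; move: (t_of s alpha) => t t0 t1 gE.
have [|||K [eB eE eF]] := @cuboid_exists (ratr (2 * `|t|)) (ratr `|t ^+ 2 - 1|) (ratr `|g|).
- by rewrite ltr0q mulr_gt0 // normr_gt0.
- by rewrite ltr0q normr_gt0 subr_eq0.
- by rewrite ltr0q normr_gt0.
exists K.
have rK : rational_face_cuboid K.
  (* The diagonals [d] and [h] come from [(2 t)^2 + (t^2 - 1)^2 = (t^2 + 1)^2] and
     [4 + (s - 1/s)^2 = (s + 1/s)^2]. *)
  apply: (rational_face_cuboid_of_sqr eB eE eF (d := t ^+ 2 + 1)
    (e := t * (s - 1 / s)) (h := t * (s + 1 / s)));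
    rewrite ?exprMn ?real_normK ?num_real //.
  - by ring.
  - by field.
split=> //.
rewrite -[LHS]ger0_norm ?HF_ge0 // -sqrtr_sqr HF_sqr eE eF -!rmorphXn -rmorphD /=.
by rewrite !real_normK ?num_real // gE.
Qed.

Lemma attached_cuboid_class (s alpha : rat) (K K' : cuboid R) :
  attached_cuboid s alpha K -> attached_cuboid s alpha K' ->
  cuboid_class K = cuboid_class K'.
Proof.
move=> [_ eB eE eH] [_ eB' eE' eH']; apply/cuboid_class_eq/(@cuboid_equiv_of _ _ 1) => //;
  by rewrite rmorph1 mul1r ?eB ?eE ?eH.
Qed.

End Cuboids.

Theorem theorem1p2 (R : realType) :
  exists phi : rat * rat * rat -> set (cuboid R),
    [/\ (forall s alpha beta : rat, tildeA (s, alpha, beta) ->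
           exists K : cuboid R, attached_cuboid s alpha K),
        (forall (s alpha beta : rat) (K : cuboid R), tildeA (s, alpha, beta) ->
           attached_cuboid s alpha K -> phi (s, alpha, beta) = cuboid_class K),
        set_fun tildeA (face_classes R) phi
      & set_surj tildeA (face_classes R) phi].
Proof.
(* The union of the classes of all attached cuboids; these classes coincide, so no cuboid has to be
   chosen. *)
pose phi (p : rat * rat * rat) : set (cuboid R) := fun J =>
  exists2 K, attached_cuboid p.1.1 p.1.2 K & cuboid_class K J.
have phiE s alpha beta K : attached_cuboid s alpha K -> phi (s, alpha, beta) = cuboid_class K.
  move=> hK; apply/seteqP; split=> J; last by exists K.
  by move=> [K' hK']; rewrite (attached_cuboid_class hK' hK).
exists phi; split=> [||[[s alpha] beta] hp|c].
- exact: attached_cuboid_exists.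
- by move=> s alpha beta K _; exact: phiE.
- have [K hK] := attached_cuboid_exists R hp.
  by exists K; [case: hK|rewrite (phiE _ _ _ _ hK)].
move=> [K [[[x ex] [y ey] [z ez]] [[d ed] [e ee] [h eh]]] <-].
have pos q (r : R) : 0 < r -> r = ratr q -> 0 < q by move=> + rq; rewrite rq ltr0q.
have x0 := pos _ _ (BF_gt0 K) ex; have y0 := pos _ _ (EF_gt0 K) ey.
have z0 := pos _ _ (FG_gt0 K) ez.
have B0 := BF_gt0 K; have E0 := EF_gt0 K.
have pos' (r r' : R) q : 0 <= r -> 0 < r' -> r ^+ 2 = r' ^+ 2 + q ^+ 2 -> 0 < r.
  move=> r0 r1 e2; rewrite lt_neqAle r0 andbT eq_sym -sqrf_eq0 e2.
  by rewrite gt_eqF // ltr_wpDr ?sqr_ge0 // exprn_gt0.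
have d0 := pos _ _ (pos' _ _ _ (BE_ge0 K) B0 (BE_sqr K)) ed.
have e0 := pos _ _ (pos' _ _ _ (HF_ge0 K) E0 (HF_sqr K)) ee.
have h0 := pos _ _ (pos' _ _ _ (DF_ge0 K) B0 (DF_sqr K)) eh.
have sq (q r t : rat) : ratr q ^+ 2 = ratr r ^+ 2 + ratr t ^+ 2 :> R -> r ^+ 2 + t ^+ 2 = q ^+ 2.
  by rewrite -!rmorphXn -rmorphD => /fmorph_inj.
have xyd : x ^+ 2 + y ^+ 2 = d ^+ 2 by apply: sq; rewrite -ex -ey -ed BE_sqr.
have yze : y ^+ 2 + z ^+ 2 = e ^+ 2 by apply: sq; rewrite -ey -ez -ee HF_sqr.
have xeh : x ^+ 2 + e ^+ 2 = h ^+ 2 by apply: sq; rewrite -ex -ee -eh DF_sqr.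
(* The lengths of a cuboid attached to these parameters are [l] times those of [K]. *)
have [s [alpha [beta [l [l0 hp tx ty te]]]]] := edge_param_inv x0 y0 z0 d0 e0 h0 xyd yze xeh.
exists (s, alpha, beta) => //.
have [J hJ] := attached_cuboid_exists R hp.
rewrite (phiE _ _ _ _ hJ); apply/cuboid_class_eq/(cuboid_equiv_of l0).
- by have [_ -> _ _] := hJ; rewrite tx rmorphM ex.
- by have [_ _ -> _] := hJ; rewrite ty rmorphM ey.
have [_ _ _ ->] := hJ; rewrite te rmorphXn sqrtr_sqr ger0_norm; first by rewrite rmorphM ee.
by rewrite ler0q mulr_ge0 ?ltW.
Qed.
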